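(* Let $(\Omega,\mathcal L,\mu)$ be a measure space, $X$ a Banach space, and let $\widetilde{\Gamma}\colon\Omega\to\mathcal F(X)$ be a scalarly integrable fuzzy mapping determined by a space $Y\subseteq X$ such that $Y^*$ is weak$^*$-angelic, and such that for each $r\in(0,1]$ the operator $T_r\colon X^*\to L^1(\mu)$, $T_r(x^* )=s(x^*,\widetilde{\Gamma}_r)$, is weakly compact. Then $\widetilde{\Gamma}$ is a Pettis integrable fuzzy mapping.
   Context: $(\Omega,\mathcal L,\mu)$ is a measure space, $\mathcal L$ being the family of all $\mu$-measurable sets; $X$ is a (real) Banach space with dual $X^*$. $cwk(X)$ is the family of nonempty convex weakly compact subsets of $X$. For $A\in cwk(X)$ and $x^*\in X^*$, $s(x^*,A)=\sup\{\langle x^*,y\rangle: y\in A\}$. Fuzzy numbers: for $u\colon X\to[0,1]$ and $r\in(0,1]$ put $[u]^r=\{x\in X: u(x)\ge r\}$. $u$ is a generalized fuzzy number if $[u]^r\in cwk(X)$ for every $r\in(0,1]$; $\mathcal F(X)$ is the set of all generalized fuzzy numbers. A fuzzy mapping is a map $\widetilde{\Gamma}\colon\Omega\to\mathcal F(X)$; set $\widetilde{\Gamma}_r(\omega):=[\widetilde{\Gamma}(\omega)]^r$, and $s(x^*,\widetilde{\Gamma}_r)$ denotes the function $\omega\mapsto s(x^*,\widetilde{\Gamma}_r(\omega))$. A multifunction $\Gamma\colon\Omega\to cwk(X)$ is scalarly integrable if $s(x^*,\Gamma)$ is $\mu$-integrable for each $x^*\in X^*$; it is Pettis integrable if moreover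 for each $A\in\mathcal L$ there is $W_\Gamma(A)\in cwk(X)$ with $s(x^*,W_\Gamma(A))=\int_A s(x^*,\Gamma)\,d\mu$ for all $x^*\in X^*$. A fuzzy mapping $\widetilde{\Gamma}$ is scalarly integrable if $\widetilde{\Gamma}_r$ is scalarly integrable for all $r\in(0,1]$. It is Pettis integrable if every $\widetilde{\Gamma}_r$, $r\in(0,1]$, is a Pettis integrable multifunction and, for each $A\in\mathcal L$, there is $\widetilde{M_\Gamma}(A)\in\mathcal F(X)$ such that $s(x^*,[\widetilde{M_\Gamma}(A)]^r)=\int_A s(x^*,\widetilde{\Gamma}_r)\,d\mu$ for all $r\in(0,1]$ and $x^*\in X^*$. A (linear sub)space $Y\subseteq X$ determines $\widetilde{\Gamma}$ if for each $r\in(0,1]$ and each $x^*\in Y^\perp$ (the annihilator of $Y$ in $X^*$) $s(x^*,\widetilde{\Gamma}_r)=0$ $\mu$-a.e., the exceptional sets depending on $x^*$ and $r$. A dual space $Y^*$ is weak$^*$-angelic if for each bounded $B\subset Y^*$ the weak$^*$-closure of $B$ equals the set of weak$^*$-limits of sequences from $B$. The (not necessarily linear) operator $T_r$ is weakly compact if it maps bounded subsets of $X^*$ to relatively weakly compact subsets of $L^1(\mu)$. *)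

(* Defs.v *)
From HB Require Import structures.
From mathcomp Require Import all_boot all_order all_algebra.
From mathcomp Require Import all_classical all_reals all_analysis.

Set Implicit Arguments.
Unset Strict Implicit.
Unset Printing Implicit Defensive.

Import Order.TTheory GRing.Theory Num.Theory.
Import numFieldNormedType.Exports.

Local Open Scope classical_set_scope.
Local Open Scope ring_scope.

(* Duals are taken of seminormed spaces (V, p). This covers uniformly a normed
   space with its norm, a linear subspace with the restricted norm, and L^1(mu)
   presented by functions instead of classes of functions modulo equality
   almost everywhere. *)
Section Duality.
Context (R : realType) (V : lmodType R) (p : V -> R).

Record dual := Dual {
  dual_fun :> {linear V -> R^o};
  dual_bounded : exists M : R, forall v, `|dual_fun v| <= M * p v }.

HB.instance Definition _ := gen_eqMixin dual.
HB.instance Definition _ := gen_choiceMixin dual.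

Definition dual_bounded_set (B : set dual) :=
  exists M : R, forall f, B f -> forall v, `|f v| <= M * p v.

Definition bidual_eval (v : V) : {ptws dual -> R} := fun f => f v.

Definition weak_topology : Type := initial_topology bidual_eval.

HB.instance Definition _ := Topological.on weak_topology.

Definition dual_eval (f : dual) : {ptws V -> R} := fun v => f v.

Definition weak_star_topology : Type := initial_topology dual_eval.

HB.instance Definition _ := Topological.on weak_star_topology.

Definition weak_star_angelic :=
  forall B : set dual, dual_bounded_set B ->
    closure (B : set weak_star_topology) =
    [set f : weak_star_topology | exists u : nat -> weak_star_topology,
       (forall n, B (u n)) /\ u n @[n --> \oo] --> f].

End Duality.

Arguments weak_topology {R V} p.
Arguments weak_star_topology {R V} p.
Arguments weak_star_angelic {R V} p.

Notation norm_dual X := (dual (fun x : X => `|x|)).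
Notation norm_weak_topology X := (weak_topology (fun x : X => `|x|)).

(* So norm_dual X consists of the continuous linear functionals on X. *)
Lemma continuous_dual_bounded (R : realType) (X : normedModType R)
    (f : {linear X -> R^o}) :
  continuous f <-> exists M : R, forall x, `|f x| <= M * `|x|.
Proof.
split=> [cf|[M fM]].
  have /linear_boundedP/pinfty_ex_gt0[M _ fM] :=
    continuous_linear_bounded 0 (cf 0).
  by exists M.
apply/linear_bounded_continuous/linear_boundedP.
by near=> r => x; rewrite (le_trans (fM x))// ler_wpM2r//; near: r;
  apply: nbhs_pinfty_ge; rewrite num_real.
Unshelve. all: by end_near. Qed.

Section Subspace.
Context (R : realType) (X : normedModType R) (Y : submodClosed X).

Definition subspace_type : Type := {x : X | x \in Y}.

HB.instance Definition _ := SubType.on subspace_type.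
HB.instance Definition _ := [Choice of subspace_type by <:].
HB.instance Definition _ := [SubChoice_isSubLmodule of subspace_type by <:].

Definition subspace_norm (y : subspace_type) : R := `|val y|.

Definition annihilator : set (norm_dual X) :=
  [set f | forall y, y \in Y -> f y = 0].

End Subspace.

Section SupportFunction.
Context (R : realType) (X : normedModType R).

Definition cwk (A : set X) :=
  [/\ A !=set0, convex_set (A : set (convex_lmodType X)) &
      compact (A : set (norm_weak_topology X))].

(* The supremum is a real number: a cwk set is nonempty and the image of a weakly
   compact set by f is bounded. *)
Definition supp (f : norm_dual X) (A : set X) : R := sup [set f y | y in A].

Definition level (u : X -> R) (r : R) : set X := [set x | r <= u x].

Record fuzzy_number := FuzzyNumber {
  fuzzy_fun :> X -> R;
  fuzzy_fun01 : forall x, 0 <= fuzzy_fun x <= 1;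
  fuzzy_level : forall r, 0 < r <= 1 -> cwk (level fuzzy_fun r) }.

End SupportFunction.

Section Integrability.
Context (d : measure_display) (Omega : measurableType d) (R : realType).
Context (mu : {measure set Omega -> \bar R}) (X : normedModType R).

Definition scalarly_integrable (G : Omega -> set X) :=
  forall f : norm_dual X,
    mu.-integrable setT (fun w => (supp f (G w))%:E).

Definition pettis_integrable (G : Omega -> set X) :=
  scalarly_integrable G /\
  forall A, measurable A -> exists2 W : set X, cwk W &
    forall f : norm_dual X,
      (supp f W)%:E = (\int[mu]_(w in A) (supp f (G w))%:E)%E.

Definition fuzzy_scalarly_integrable (G : Omega -> fuzzy_number X) :=
  forall r, 0 < r <= 1 -> scalarly_integrable (fun w => level (G w) r).

Definition fuzzy_pettis_integrable (G : Omega -> fuzzy_number X) :=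
  (forall r, 0 < r <= 1 -> pettis_integrable (fun w => level (G w) r)) /\
  forall A, measurable A -> exists M : fuzzy_number X,
    forall r, 0 < r <= 1 -> forall f : norm_dual X,
      (supp f (level M r))%:E =
      (\int[mu]_(w in A) (supp f (level (G w) r))%:E)%E.

Definition determines (Y : submodClosed X) (G : Omega -> fuzzy_number X) :=
  forall r, 0 < r <= 1 -> forall f, annihilator Y f ->
    \forall w \ae mu, supp f (level (G w) r) = 0.

(* The elements of L1 are functions; the weak topology of L1_seminorm does not
   separate functions equal almost everywhere, and its quotient by this
   relation is the usual weak topology of L^1(mu). Hence a set of functions is
   relatively weakly compact iff the corresponding set of classes is. *)
Definition L1 := LfunType mu (lexx 1%E).

Definition L1_seminorm (g : L1) : R := fine ('N[mu]_1[EFin \o g])%E.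

Lemma scalarly_integrable_Lfun (G : Omega -> set X)
    (hG : scalarly_integrable G) (f : norm_dual X) :
  (fun w => supp f (G w)) \in Lfun mu 1%E.
Proof. exact/Lfun1_integrable/hG. Qed.

Definition supp_op (G : Omega -> set X) (hG : scalarly_integrable G)
    (f : norm_dual X) : L1 :=
  Lfun_Sub (lexx 1%E) (scalarly_integrable_Lfun hG f).

Definition weakly_compact_op (T : norm_dual X -> L1) :=
  forall B : set (norm_dual X), dual_bounded_set B ->
    precompact (T @` B : set (weak_topology L1_seminorm)).

End Integrability.

(* Main.v *)
Require Import Defs.
From HB Require Import structures.
From mathcomp Require Import all_boot all_order all_algebra.
From mathcomp Require Import all_classical all_reals all_analysis.
From mathcomp Require Import measurable_realfun ring lra.
Import Order.TTheory GRing.Theory Num.Theory.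
Import numFieldNormedType.Exports.
Local Open Scope classical_set_scope.
Local Open Scope ring_scope.

Set Implicit Arguments.
Unset Strict Implicit.
Unset Printing Implicit Defensive.

(* Fix a level r and a measurable set A and put phi f = \int_A s(f, G w). A sublinear
   functional phi on the dual of X is the support function of a convex weakly compact
   set as soon as every linear z <= phi is the evaluation at a point of X. By
   Grothendieck's theorem it suffices that for each e > 0 some finite subset of X
   forces z f <= e on the f of the unit ball vanishing on it. Otherwise angelicity of
   the dual of Y gives f_n in the unit ball with z f_n > e and f_n -> 0 pointwise on
   Y, and weak compactness of T_r together with Mazur's lemma gives convex
   combinations g_n of the f_n with |g_n x| <= H w on the graph {(w, x) | x in G w},
   where H is integrable.

   Suppose phi >= e on the convex hull of the g_n. By Hahn-Banach there is a positive
   linear functional L, on the functions on the graph dominated by multiples of H,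
   bounded by the upper integral of F |-> sup_x F (w, x), with L >= e on the hull.
   Almost minimising L (c ^ 2 / H) over the tails of the hull produces c_n with
   \sum_n L |c_n - c_(n+1)| <= e / 2. Every average of c_0, ..., c_m is at least
   c_0 - \sum_(n < m) |c_n - c_(n+1)|, hence e <= L c_0 is at most e / 2 plus the
   integral of the minimum of the support functions of finitely many averages. For
   almost every w the infimum over all averages is <= 0, by minimax and because a weak*
   cluster point of the c_n annihilates Y; dominated convergence then gives a
   contradiction.

   Finally the sets obtained for the levels r are the levels of a fuzzy number, by
   dominated convergence as q increases to r. *)

(** * Hahn-Banach theorems *)

Section Sublinear.
Context (R : realType) (V : lmodType R).
Implicit Types (p : V -> R) (S : set (V * R)) (v : V).

Definition sublinear p :=
  (forall u v, p (u + v) <= p u + p v) /\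
  (forall t v, 0 <= t -> p (t *: v) = t * p v).

Lemma sublinear0 p : sublinear p -> p 0 = 0.
Proof. by case=> _ /(_ 0 0 (lexx _)); rewrite scale0r mul0r. Qed.

Lemma sublinearN p v : sublinear p -> - p (- v) <= p v.
Proof.
move=> hp; have [/(_ v (- v)) + _] := hp.
by rewrite subrr sublinear0//; lra.
Qed.

Lemma sublinearP p : p 0 = 0 -> (forall u v, p (u + v) <= p u + p v) ->
  (forall t v, 0 < t -> p (t *: v) <= t * p v) -> sublinear p.
Proof.
move=> p0 pD pZ; split=> // t v.
rewrite le_eqVlt => /predU1P[<-|t0]; first by rewrite scale0r mul0r.
apply/eqP; rewrite eq_le pZ//= -ler_pdivlMl//.
have /pZ : 0 < t^-1 by rewrite invr_gt0.
by move=> /(_ (t *: v)); rewrite scalerA mulVf ?gt_eqF// scale1r.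
Qed.

(** A pair [(v, a)] stands for the constraint [a <= l v] on a linear functional [l]. *)
Definition cone S :=
  [/\ S (0, 0), (forall s t, S s -> S t -> S (s.1 + t.1, s.2 + t.2)) &
      (forall r s, 0 <= r -> S s -> S (r *: s.1, r * s.2))].

Definition ray v (a : R) : set (V * R) :=
  [set (t *: v, t * a) | t in [set t : R | 0 <= t]].

Lemma ray_cone v a : cone (ray v a).
Proof.
split.
- by exists 0; rewrite /= ?lexx// scale0r mul0r.
- move=> _ _ [s /= s0 <-] [t /= t0 <-]; exists (s + t); first exact: addr_ge0.
  by rewrite scalerDl mulrDl.
- move=> r _ r0 [s /= s0 <-]; exists (r * s); first exact: mulr_ge0.
  by rewrite scalerA mulrA.
Qed.

Lemma ray_id v a : ray v a (v, a).
Proof. by exists 1; rewrite ?scale1r ?mul1r /=. Qed.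

Lemma ray_le p v : sublinear p -> forall s, ray v (p v) s -> s.2 <= p s.1.
Proof. by move=> [_ pZ] _ [t t0 <-] /=; rewrite pZ. Qed.

(** A linear [l] below this functional lies below [p] (use the pair [(0, 0)]) and satisfies the
    constraints in [S] (evaluate at [- s.1]). *)
Definition inf_cone p S v := inf [set p (v + s.1) - s.2 | s in S].

Section InfCone.
Variables (p : V -> R) (S : set (V * R)).
Hypotheses (hp : sublinear p) (hS : cone S).
Hypothesis Sp : forall s, S s -> s.2 <= p s.1.

Let inf_cone_lb v : lbound [set p (v + s.1) - s.2 | s in S] (- p (- v)).
Proof.
move=> _ [s Ss <-]; have [/(_ (v + s.1) (- v)) + _] := hp.
by rewrite addrAC subrr add0r => h; have := Sp Ss; lra.
Qed.

Let inf_cone_has v : has_inf [set p (v + s.1) - s.2 | s in S].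
Proof.
split; last by exists (- p (- v)); exact: inf_cone_lb.
by have [S0 _ _] := hS; exists (p (v + 0) - 0); exists (0, 0).
Qed.

Lemma inf_cone_le v s : S s -> inf_cone p S v <= p (v + s.1) - s.2.
Proof. by move=> Ss; apply: ge_inf; [exact: (inf_cone_has v).2|exists s]. Qed.

Lemma inf_cone_lep v : inf_cone p S v <= p v.
Proof.
by have [S0 _ _] := hS; have := inf_cone_le v S0; rewrite addr0 subr0.
Qed.

Lemma inf_cone_sublinear : sublinear (inf_cone p S).
Proof.
have [S0 SD SZ] := hS; have [pD pZ] := hp.
apply: sublinearP => [|u v|t v t0].
- apply/eqP; rewrite eq_le; apply/andP; split.
    by have := inf_cone_lep 0; rewrite (sublinear0 hp).
  apply: lb_le_inf; first exact: (inf_cone_has 0).1.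
  by have := @inf_cone_lb 0; rewrite oppr0 (sublinear0 hp) oppr0.
- apply/ler_addgt0Pr => e e0; have e20 : 0 < e / 2 by rewrite divr_gt0.
  have [_ [s Ss <-] hs] := inf_adherent e20 (inf_cone_has u).
  have [_ [t St <-] ht] := inf_adherent e20 (inf_cone_has v).
  have := inf_cone_le (u + v) (SD _ _ Ss St) => /=.
  have := pD (u + s.1) (v + t.1); rewrite (addrACA u).
  by rewrite /inf_cone in hs ht *; lra.
- rewrite -ler_pdivrMl//; apply: lb_le_inf; first exact: (inf_cone_has v).1.
  move=> _ [s Ss <-]; rewrite ler_pdivrMl// mulrBr -pZ ?(ltW t0)// scalerDr.
  exact: (inf_cone_le _ (SZ _ _ (ltW t0) Ss)).
Qed.

Lemma inf_coneN s : S s -> inf_cone p S (- s.1) <= - s.2.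
Proof.
by move=> /(inf_cone_le (- s.1)); rewrite addNr (sublinear0 hp) sub0r.
Qed.

End InfCone.

(* By minimality v |-> inf_(t >= 0) (p (v + t c) - t p c) is p itself, and its value
   at - c is at most - p c; hence p is odd. *)
Lemma minimal_sublinear_linear p : sublinear p ->
  (forall q, sublinear q -> (forall v, q v <= p v) -> q = p) -> linear (p : V -> R^o).
Proof.
move=> hp pmin; have [pD pZ] := hp.
have pN c : p (- c) = - p c.
  have hS := ray_cone c (p c); have Sp := ray_le hp (v := c).
  have /(congr1 (@^~ (- c))) /= h :=
    pmin _ (inf_cone_sublinear hp hS Sp) (inf_cone_lep hp hS Sp).
  apply/eqP; rewrite eq_le; apply/andP; split.
    rewrite -h; exact: (inf_coneN hp hS Sp (ray_id c (p c))).
  by have := sublinearN c hp; lra.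
have pZ' t v : p (t *: v) = t * p v.
  have [/pZ//|t0] := lerP 0 t.
  have : p (- (- t *: v)) = - ((- t) * p v) by rewrite pN pZ// oppr_ge0 ltW.
  by rewrite scaleNr opprK mulNr opprK.
move=> t u v; rewrite -[LHS]/(p _); apply/eqP; rewrite eq_le; apply/andP; split.
  by rewrite (le_trans (pD _ _))// pZ'.
have := pD (t *: u + v) (- v); rewrite addrK pN pZ'.
by rewrite /GRing.scale/=; lra.
Qed.

(** Zorn's lemma for the reversed pointwise order. Sublinear minorants of [p] are at least
    [- p (- v)] at [v], so a nonempty chain has a pointwise infimum; it is subadditive because the
    smaller of two near-optimal members serves both arguments. *)
Lemma exists_minimal_sublinear p : sublinear p ->
  exists q, [/\ sublinear q, (forall v, q v <= p v) &
    forall q', sublinear q' -> (forall v, q' v <= q v) -> q' = q].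
Proof.
move=> hp.
pose T := {q : V -> R | sublinear q /\ forall v, q v <= p v}.
pose Rel : rel T := fun q q' : T => `[< forall v, sval q' v <= sval q v >].
have [||||q qmax] := @Zorn T Rel.
- by move=> q; apply/asboolP.
- move=> q1 q2 q3 /asboolP h1 /asboolP h2; apply/asboolP => v.
  exact: le_trans (h2 v) (h1 v).
- move=> [q1 h1] [q2 h2] /asboolP/= h12 /asboolP/= h21.
  have e : q1 = q2 by apply/funext => v; apply/le_anti; rewrite h12 h21.
  by subst q2; congr exist; exact: Prop_irrelevance.
- move=> A totA; have [[q0 Aq0]|/forallNP A0] := pselect (exists q : T, A q); last first.
    by exists (exist _ p (conj hp (fun v => lexx _))) => s /A0.
  have lbA v : has_inf [set sval q v | q in A].
    split; first by exists (sval q0 v); exists q0.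
    exists (- p (- v)) => _ [[q [hq qp]] _ <-] /=.
    by apply: le_trans (sublinearN v hq); rewrite lerN2.
  pose m v := inf [set sval q v | q in A].
  have mle v (q : T) : A q -> m v <= sval q v.
    by move=> Aq; apply: ge_inf; [exact: (lbA v).2|exists q].
  have hm : sublinear m.
    apply: sublinearP => [|u v|t v t0].
    - rewrite /m (_ : [set _ | _ in _] = [set 0]) ?inf1//.
      apply/seteqP; split=> [_ [q _ <-]/=|_ ->].
        by rewrite sublinear0//; exact: (svalP q).1.
      by exists q0 => //; rewrite sublinear0//; exact: (svalP q0).1.
    - apply/ler_addgt0Pr => e e0; have e20 : 0 < e / 2 by rewrite divr_gt0.
      have [_ [q1 A1 <-] h1] := inf_adherent e20 (lbA u).
      have [_ [q2 A2 <-] h2] := inf_adherent e20 (lbA v).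
      rewrite -/(m u) -/(m v) in h1 h2.
      have /orP[/asboolP h|/asboolP h] : Rel q1 q2 || Rel q2 q1.
          by apply/orP; exact: totA.
        have [[/(_ u v) + _] _] := svalP q2.
        by have := mle (u + v) _ A2; have := h u; lra.
      have [[/(_ u v) + _] _] := svalP q1.
      by have := mle (u + v) _ A1; have := h v; lra.
    - rewrite -ler_pdivrMl//; apply: lb_le_inf; first exact: (lbA v).1.
      move=> _ [q Aq <-]; rewrite ler_pdivrMl//.
      by rewrite -(svalP q).1.2 ?(ltW t0)//; exact: mle.
  have mp v : m v <= p v by apply: le_trans (mle v _ Aq0) _; exact: (svalP q0).2.
  by exists (exist _ m (conj hm mp)) => s As; apply/asboolP => v; exact: mle.
exists (sval q); split; [exact: (svalP q).1|exact: (svalP q).2|].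
move=> q' hq' q'q.
have q'p v : q' v <= p v by apply: le_trans (q'q v) ((svalP q).2 v).
pose t : T := exist _ q' (conj hq' q'p).
have /(congr1 sval)/= -> // : t = q by apply: qmax; exact/asboolP.
Qed.

Theorem sandwich p S : sublinear p -> cone S -> (forall s, S s -> s.2 <= p s.1) ->
  exists l : {linear V -> R^o}, (forall v, l v <= p v) /\
    (forall s, S s -> s.2 <= l s.1).
Proof.
move=> hp hS Sp.
have [q [hq qp qmin]] := exists_minimal_sublinear (inf_cone_sublinear hp hS Sp).
have lq := minimal_sublinear_linear hq qmin.
pose aux := GRing.isLinear.Build R V R^o *:%R q lq.
pose l : {linear V -> R^o} := HB.pack (q : V -> R^o) aux.
exists l; split=> [v|s Ss]; first exact: le_trans (qp v) (inf_cone_lep hp hS Sp v).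
have := le_trans (qp (- s.1)) (inf_coneN hp hS Sp Ss).
by rewrite -[q _]/(l _) linearN lerN2.
Qed.

Corollary hahn_banach p v : sublinear p ->
  exists l : {linear V -> R^o}, (forall v, l v <= p v) /\ l v = p v.
Proof.
move=> hp; have [l [lp lS]] := sandwich hp (ray_cone v (p v)) (ray_le hp (v := v)).
exists l; split=> //; apply/eqP; rewrite eq_le lp/=.
exact: (lS _ (ray_id v (p v))).
Qed.

Definition convex (C : set V) := forall x y t, 0 <= t <= 1 -> C x -> C y ->
  C (t *: x + (1 - t) *: y).

Corollary sandwich_convex p (C : set V) a : sublinear p -> convex C -> C !=set0 ->
  (forall c, C c -> a <= p c) ->
  exists l : {linear V -> R^o}, (forall v, l v <= p v) /\
    (forall c, C c -> a <= l c).
Proof.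
move=> hp cC [c0 Cc0] Cp; have [_ pZ] := hp.
pose S := [set s | exists t c, [/\ 0 <= t, C c & s = (t *: c, t * a)]].
have hS : cone S.
  split.
  - by exists 0, c0; rewrite scale0r mul0r.
  - move=> _ _ [s [c [s0 Cc ->]]] [t [d [t0 Cd ->]]]; exists (s + t) => /=.
    (* When both multipliers are zero the sum cannot be normalised, and any point of [C] represents
       it. *)
    have [st|] := eqVneq (s + t) 0.
      have s00 : s = 0 by lra.
      have t00 : t = 0 by lra.
      by exists c; split; rewrite ?s00 ?t00 ?addr0 //= !scale0r !mul0r !addr0.
    move=> st; have st0 : 0 < s + t by rewrite lt0r st addr_ge0.
    exists ((s / (s + t)) *: c + (1 - s / (s + t)) *: d); split.
    + exact: ltW.
    + apply: cC => //; rewrite divr_ge0 ?(ltW st0)//=.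
      by rewrite ler_pdivrMr// mul1r lerDl.
    + rewrite scalerDr !scalerA; congr (_ *: _ + _ *: _, _); [by field|by field|by ring].
  - move=> r _ r0 [s [c [s0 Cc ->]]]; exists (r * s), c; split => //.
      exact: mulr_ge0.
    by rewrite /= scalerA mulrA.
have Sp s : S s -> s.2 <= p s.1.
  by move=> [t [c [t0 Cc ->]]]/=; rewrite pZ// ler_wpM2l// Cp.
have [l [lp lS]] := sandwich hp hS Sp.
exists l; split=> // c Cc; apply: (lS (c, a)).
by exists 1, c; rewrite scale1r mul1r.
Qed.

End Sublinear.

(** * Duals and weak topologies *)

Lemma linear_ext (R : nzRingType) (U V : lmodType R) (f g : {linear U -> V}) :
  f =1 g -> f = g.
Proof.
move=> /funext; case: f => f [[h1] [h2]]; case: g => g [[k1] [k2]] /= fg; subst g.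
by rewrite (Prop_irrelevance h1 k1) (Prop_irrelevance h2 k2).
Qed.

Section DualModule.
Context (R : realType) (V : lmodType R) (p : V -> R).
Implicit Types f g : dual p.

Lemma dual_ext f g : f =1 g -> f = g.
Proof.
case: f => f hf; case: g => g hg /linear_ext /= fg.
by subst g; congr Dual; exact: Prop_irrelevance.
Qed.

Lemma dual_zero_bounded : exists M : R, forall v, `|(\0 : V -> R^o) v| <= M * p v.
Proof. by exists 0 => v; rewrite normr0 mul0r. Qed.

Lemma dual_opp_bounded f : exists M : R, forall v, `|(\- f : V -> R^o) v| <= M * p v.
Proof. by have [M fM] := dual_bounded f; exists M => v; rewrite normrN. Qed.

Lemma dual_add_bounded f g :
  exists M : R, forall v, `|(f \+ g : V -> R^o) v| <= M * p v.
Proof.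
have [[M fM] [N gN]] := (dual_bounded f, dual_bounded g).
by exists (M + N) => v; rewrite (le_trans (ler_normD _ _))// mulrDl lerD.
Qed.

Lemma dual_scale_bounded (a : R) f :
  exists M : R, forall v, `|(a \*: (f : V -> R^o)) v| <= M * p v.
Proof.
have [M fM] := dual_bounded f.
by exists (`|a| * M) => v; rewrite normrM -mulrA ler_wpM2l.
Qed.

Definition dual_zero : dual p := Dual dual_zero_bounded.
Definition dual_opp f : dual p := Dual (dual_opp_bounded f).
Definition dual_add f g : dual p := Dual (dual_add_bounded f g).
Definition dual_scale a f : dual p := Dual (dual_scale_bounded a f).

Let dual_addA : associative dual_add.
Proof. by move=> f g h; apply: dual_ext => v /=; rewrite addrA. Qed.

Let dual_addC : commutative dual_add.
Proof. by move=> f g; apply: dual_ext => v /=; rewrite addrC. Qed.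

Let dual_add0 : left_id dual_zero dual_add.
Proof. by move=> f; apply: dual_ext => v /=; rewrite add0r. Qed.

Let dual_addN : left_inverse dual_zero dual_opp dual_add.
Proof. by move=> f; apply: dual_ext => v /=; rewrite addNr. Qed.

HB.instance Definition _ :=
  GRing.isZmodule.Build (dual p) dual_addA dual_addC dual_add0 dual_addN.

Let dual_scaleA a b f : dual_scale a (dual_scale b f) = dual_scale (a * b) f.
Proof. by apply: dual_ext => v /=; rewrite scalerA. Qed.

Let dual_scale1 : left_id 1 dual_scale.
Proof. by move=> f; apply: dual_ext => v /=; rewrite scale1r. Qed.

Let dual_scaleDr : right_distributive dual_scale +%R.
Proof. by move=> a f g; apply: dual_ext => v /=; rewrite scalerDr. Qed.

Let dual_scaleDl f : {morph dual_scale^~ f : a b / a + b}.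
Proof. by move=> a b; apply: dual_ext => v /=; rewrite scalerDl. Qed.

HB.instance Definition _ := GRing.Zmodule_isLmodule.Build R (dual p)
  dual_scaleA dual_scale1 dual_scaleDr dual_scaleDl.

Lemma dualD f g v : (f + g) v = f v + g v. Proof. by []. Qed.
Lemma dualN f v : (- f) v = - f v. Proof. by []. Qed.
Lemma dualB f g v : (f - g) v = f v - g v. Proof. by []. Qed.
Lemma dual0 v : (0 : dual p) v = 0. Proof. by []. Qed.
Lemma dualZ (a : R) f v : (a *: f) v = a * f v. Proof. by []. Qed.

Lemma dual_sum I (s : seq I) (F : I -> dual p) v :
  (\sum_(i <- s) F i) v = \sum_(i <- s) F i v.
Proof. by elim/big_rec2 : _ => // i y g _ <-. Qed.

Lemma dual_intro (h : V -> R) (M : R) : linear (h : V -> R^o) ->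
  (forall v, `|h v| <= M * p v) -> exists f : dual p, forall v, f v = h v.
Proof.
move=> lh hM.
pose aux := GRing.isLinear.Build R V R^o *:%R h lh.
pose l : {linear V -> R^o} := HB.pack (h : V -> R^o) aux.
have hl : exists M : R, forall v, `|l v| <= M * p v by exists M.
by exists (Dual hl).
Qed.

End DualModule.

Section EvaluationMap.
Context (R : realType) (V : lmodType R) (p : V -> R).

Definition dual_at (v : V) (f : dual p) : R^o := f v.

Lemma dual_at_linear v : linear (dual_at v).
Proof. by []. Qed.

HB.instance Definition _ v :=
  GRing.isLinear.Build R (dual p) R^o *:%R (dual_at v) (dual_at_linear v).

End EvaluationMap.

Section PointwiseTopologies.
Context (R : realType).

Lemma initial_cvg (S : choiceType) (T : topologicalType) (f : S -> T)
    (F : set_system S) (s : S) : Filter F ->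
  (fun x => f x) @ F --> f s -> F --> (s : initial_topology f).
Proof.
move=> FF cvf A /= [_ [[B oB <-] Bfs sBA]].
have /cvf FB : nbhs (f s) B by apply: open_nbhs_nbhs.
by apply: filterS sBA _; exact: FB.
Qed.

Lemma initial_ptws_cvg (S : choiceType) (U : Type) (ev : S -> {ptws U -> R})
    (F : set_system S) (s : S) : Filter F ->
  (forall u, ev x u @[x --> F] --> ev s u) -> F --> (s : initial_topology ev).
Proof.
move=> FF cvev; apply: initial_cvg; apply/cvg_sup => u.
apply: (initial_cvg (f := @proj _ (fun=> R) u)); exact: cvev.
Qed.

Lemma initial_ptws_continuous (S : choiceType) (U : eqType)
    (ev : S -> {ptws U -> R}) (u : U) :
  continuous (fun s : initial_topology ev => ev s u).
Proof.
move=> s; apply: (@continuous_comp _ _ _ (ev : initial_topology ev -> _)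
  (@proj _ (fun=> R) u)); first exact: initial_continuous.
exact: proj_continuous.
Qed.

Context (V : lmodType R) (p : V -> R).

Lemma weak_cvg (F : set_system V) (v : V) : Filter F ->
  (forall f : dual p, f x @[x --> F] --> f v) -> F --> (v : weak_topology p).
Proof. by move=> FF; exact: initial_ptws_cvg. Qed.

Lemma dual_weakly_continuous (f : dual p) :
  continuous (fun v : weak_topology p => f v : R).
Proof. exact: (@initial_ptws_continuous _ _ (@bidual_eval R V p) f). Qed.

Lemma weak_star_cvg (F : set_system (dual p)) (f : dual p) : Filter F ->
  (forall v, (g v : R) @[g --> F] --> (f v : R)) ->
  F --> (f : weak_star_topology p).
Proof. by move=> FF; exact: (initial_ptws_cvg (ev := @dual_eval R V p)). Qed.

Lemma eval_weak_star_continuous (v : V) :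
  continuous (fun f : weak_star_topology p => f v : R).
Proof. exact: (@initial_ptws_continuous _ _ (@dual_eval R V p) v). Qed.

End PointwiseTopologies.

Section NormedDual.
Context (R : realType) (X : normedModType R).

Lemma norm_sublinear : sublinear (fun x : X => `|x|).
Proof. by split=> [u v|t v t0]; rewrite ?ler_normD// normrZ ger0_norm. Qed.

Lemma norming_functional (x : X) :
  exists f : norm_dual X, (forall y, `|f y| <= `|y|) /\ f x = `|x|.
Proof.
have [l [lp lx]] := hahn_banach x norm_sublinear.
have lN y : `|l y| <= 1 * `|y|.
  by rewrite mul1r ler_norml lp lerNl -linearN (le_trans (lp _))// normrN.
have [f fl] := dual_intro (linearP l) lN.
by exists f; split=> [y|]; rewrite fl// -[leRHS]mul1r.
Qed.

Lemma dual_separates (x y : X) : (forall f : norm_dual X, f x = f y) -> x = y.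
Proof.
move=> fxy; apply/eqP; rewrite -subr_eq0 -normr_eq0; apply/eqP.
by have [f [_ <-]] := norming_functional (x - y); rewrite linearB fxy subrr.
Qed.

Lemma weak_hausdorff : hausdorff_space (norm_weak_topology X).
Proof.
move=> x y xy; apply: dual_separates => f.
apply: (@Rhausdorff R) => A B /(dual_weakly_continuous (f := f)) fA.
move=> /(dual_weakly_continuous (f := f)) fB.
by have [z [/= Az Bz]] := xy _ _ fA fB; exists (f z).
Qed.

End NormedDual.

Section ConvexHull.
Context (R : realType) (V : lmodType R).

(** Closing under binary combinations avoids families of weights and makes [hull_min] a plain
    induction. *)
Inductive hull (S : set V) : V -> Prop :=
| hull_in x : S x -> hull S x
| hull_conv x y t : 0 <= t <= 1 -> hull S x -> hull S y ->
    hull S (t *: x + (1 - t) *: y).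

Lemma hull_convex (S : set V) : convex (hull S).
Proof. by move=> x y t t01 hx hy; exact: hull_conv. Qed.

Lemma hull_min (S C : set V) : convex C -> S `<=` C -> hull S `<=` C.
Proof. by move=> cC SC x; elim=> [y /SC//|y z t t01 _ Cy _ Cz]; exact: cC. Qed.

End ConvexHull.

(** * Support functions *)

(** A cluster point in the compact interval is a limit, since an ultrafilter contains each set or
    its complement. *)
Lemma ultra_bounded_cvg (R : realType) (T : Type) (F : set_system T) (h : T -> R)
    (a b : R) : UltraFilter F -> F [set t | a <= h t <= b] ->
  exists l : R, h t @[t --> F] --> l.
Proof.
move=> FU Fab.
have FF : ProperFilter F by exact: ultra_proper.
have Gab : (h @ F) [set` `[a, b]].
  by apply: (@filterS _ F _ [set t | a <= h t <= b]) => // t hab; rewrite /= in_itv.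
have [l [_ ll]] := segment_compact (F := h @ F) _ Gab.
exists l => A lA; have [//|FA] := in_ultra_setVsetC (h @^-1` A) FU.
have : (h @ F) (~` A) by [].
by move=> /ll/(_ lA) [y []].
Qed.

Lemma nested_compact (T : topologicalType) (C : nat -> set T) :
  (forall m n, (m <= n)%N -> C n `<=` C m) -> (forall n, closed (C n)) ->
  (forall n, C n !=set0) -> compact (C 0) -> exists x, forall n, C n x.
Proof.
move=> Cdec Ccl C0 cC.
have PF : ProperFilter (filter_from setT C).
  apply: filter_from_proper => [|n _]; last exact: C0.
  apply: filter_from_filter => [|m n _ _]; first by exists 0%N.
  by exists (maxn m n) => // x Cx; split; apply: Cdec Cx; rewrite ?leq_maxl ?leq_maxr.
have [|x [_ xC]] := cC _ PF; first by exists 0%N.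
exists x => n; apply: Ccl => A xA.
by have := xC (C n) A; apply => //; exists n.
Qed.

Section SupportFunction.
Context (R : realType) (X : normedModType R).
Implicit Types (f : norm_dual X) (K L : set X).

Lemma cwk_has_sup f K : cwk K -> has_sup [set f y | y in K].
Proof.
move=> [[x Kx] _ cK]; apply: compact_has_sup; first by exists (f x), x.
apply: (@continuous_compact (norm_weak_topology X) R) => //.
by apply: continuous_subspaceT; exact: dual_weakly_continuous.
Qed.

Lemma supp_ge f K x : cwk K -> K x -> f x <= supp f K.
Proof. by move=> cK Kx; apply: ub_le_sup; [exact: (cwk_has_sup f cK).2|exists x]. Qed.

Lemma supp_le f K a : K !=set0 -> (forall x, K x -> f x <= a) -> supp f K <= a.
Proof.
move=> [x Kx] Ka; apply: ge_sup; first by exists (f x), x.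
by move=> _ [y /Ka ? <-].
Qed.

Lemma supp_subset f K L : cwk K -> cwk L -> K `<=` L -> supp f K <= supp f L.
Proof. by move=> [K0 _ _] cL KL; apply: supp_le => // x /KL; exact: supp_ge. Qed.

Lemma supp_sublinear K : cwk K -> sublinear (fun f : norm_dual X => supp f K).
Proof.
move=> cK; have [[x0 Kx0] _ _] := cK.
have K0 : K !=set0 by exists x0.
apply: sublinearP => [|f g|t f t0].
- by apply/eqP; rewrite eq_le supp_le//= (supp_ge 0 cK Kx0).
- by apply: supp_le => // x Kx; rewrite dualD lerD// supp_ge.
- by apply: supp_le => // x Kx; rewrite dualZ ler_pM2l// supp_ge.
Qed.

Lemma supp_attained f K : cwk K -> exists2 x, K x & f x = supp f K.
Proof.
move=> cK; have [K0 _ kK] := cK.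
have cont : {within (K : set (norm_weak_topology X)), continuous (fun y => f y : R)}.
  by apply: continuous_subspaceT; exact: dual_weakly_continuous.
have [x Kx fx] := @compact_EVT_max (norm_weak_topology X) _ _ _ K0 kK cont.
exists x; first by rewrite inE in Kx.
apply/eqP; rewrite eq_le supp_ge//=; last by rewrite inE in Kx.
by apply: supp_le => // y Ky; apply: fx; rewrite inE.
Qed.

Lemma cwk_closed K : cwk K -> closed (K : set (norm_weak_topology X)).
Proof. by move=> [_ _ /compact_closed]; apply; exact: weak_hausdorff. Qed.

Lemma cwk_convex K : cwk K -> convex K.
Proof.
move=> [_ cK _] x y t t01 /mem_set Kx /mem_set Ky.
have [t0 t1] := andP t01.
by have := cK x y (Itv01 t0 t1) Kx Ky; rewrite inE.
Qed.

End SupportFunction.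

(** * A minimax theorem on convex weakly compact sets *)

Section Representation.
Context (R : realType) (X : normedModType R).
Implicit Types (f g : norm_dual X) (K : set X).

Lemma exists_large_nat (c d : R) : 0 < d -> exists N : nat, c < N%:R * d.
Proof.
move=> d0; exists (Num.truncn (c / d)).+1.
by rewrite -ltr_pdivrMr// truncnS_gt.
Qed.

(* Nonnegative weights are replaced by multiplicities in a list of indices. *)
Lemma approx_weights (n : nat) (lam : nat -> R) (M : R) :
  0 <= M -> (forall i, 0 <= lam i) ->
  exists s : seq nat, forall (y : nat -> R),
    \sum_(i <- s) y i <= M * (\sum_(i < n) lam i * y i) + \sum_(i < n) `|y i|.
Proof.
move=> M0 lam0; elim: n => [|n [s sP]].
  by exists [::] => z; rewrite !big_ord0 big_nil mulr0 addr0.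
exists (nseq (Num.truncn (M * lam n)) n ++ s) => z.
rewrite big_cat big_nseq iter_addr_0 !big_ord_recr/= mulrDr.
have := sP z; suff : z n *+ Num.truncn (M * lam n) <= M * (lam n * z n) + `|z n|.
  by lra.
rewrite -mulr_natr mulrA [_ * z n]mulrC.
have /andP[] : (Num.truncn (M * lam n))%:R <= M * lam n < (Num.truncn (M * lam n)).+1%:R.
  by apply: truncn_itv; exact: mulr_ge0.
rewrite -natr1; set m := (Num.truncn _)%:R => h1 h2.
rewrite -lerBlDl -mulrBr (le_trans (ler_norm _))// normrM ler_piMr//.
by rewrite ler_norml; apply/andP; split; lra.
Qed.

(** If the conclusion fails, the vectors with coordinates [c i x - a] form a convex set on which the
    negative parts sum to at least [e]. Separation gives weights [lam i >= 0] with
    [\sum_i lam i * (c i x - a) <= - e] on [K]; a large multiple of them, rounded to multiplicities,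
    is a list contradicting the hypothesis. *)
Lemma minimax_finite K (c : nat -> norm_dual X) (a e : R) n :
  cwk K -> 0 < e ->
  (forall s : seq nat, a * (size s)%:R <= supp (\sum_(i <- s) c i) K) ->
  exists2 x, K x & forall i, (i < n)%N -> a - e <= c i x.
Proof.
move=> cK e0 hc; apply: contrapT => hK.
have {}hK x : K x -> exists2 i, (i < n)%N & c i x < a - e.
  move=> Kx; apply: contrapT => hx; apply: hK; exists x => // i ni.
  by rewrite leNgt; apply/negP => cix; apply: hx; exists i.
have [K0 _ _] := cK.
pose p (v : 'rV[R]_n) := \sum_(i < n) Num.max (- v 0 i) 0.
have hp : sublinear p.
  apply: sublinearP => [|u v|t v t0].
  - by rewrite /p big1// => i _; rewrite mxE oppr0 maxxx.
  - rewrite /p -big_split/= ler_sum// => i _.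
    rewrite mxE ge_max addr_ge0 ?le_max ?lexx ?orbT//.
    by rewrite opprD lerD// le_max lexx.
  - rewrite /p mulr_sumr ler_sum// => i _.
    rewrite mxE ge_max mulr_ge0 ?(ltW t0) ?le_max ?lexx ?orbT//.
    by rewrite andbT -mulrN ler_pM2l// le_max lexx.
pose C : set 'rV[R]_n := [set \row_(i < n) (c i x - a) | x in K].
have cC : convex C.
  move=> _ _ t t01 [x Kx <-] [y Ky <-]; exists (t *: x + (1 - t) *: y).
    exact: cwk_convex.
  by apply/rowP => i; rewrite !mxE linearD !linearZ/= /GRing.scale/=; ring.
have C0 : C !=set0 by have [x Kx] := K0; eexists; exists x.
have Cp v : C v -> e <= p v.
  move=> [x /hK [i ni cix] <-]; rewrite /p (bigD1 (Ordinal ni))//= mxE/=.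
  apply: (@le_trans _ _ (Num.max (- (c i x - a)) 0)).
    by rewrite le_max; apply/orP; left; lra.
  by rewrite lerDl sumr_ge0// => j _; rewrite le_max lexx orbT.
have [l [lp lC]] := sandwich_convex hp cC C0 Cp.
pose lam i := if insub i is Some j then - l (delta_mx 0 (j : 'I_n)) else 0.
have lamE (i : 'I_n) : lam i = - l (delta_mx 0 i) by rewrite /lam valK.
have lam0 i : 0 <= lam i.
  rewrite /lam; case: insubP => // j _ _; rewrite oppr_ge0 (le_trans (lp _))//.
  rewrite /p big1// => k _; rewrite mxE eqxx/=.
  by apply/max_idPr; rewrite oppr_le0.
(* The sum bounds the error of rounding the weights to integers; the factor [N] below makes
   [N%:R * e] exceed it. *)
have [B hB] : exists B, forall x, K x -> \sum_(i < n) `|c i x - a| <= B.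
  exists (\sum_(i < n) (Num.max (supp (c i) K) (supp (- c i) K) + `|a|)) => x Kx.
  apply: ler_sum => i _; rewrite (le_trans (ler_normB _ _))// lerD2r.
  rewrite le_max; apply/orP; case: ger0P => _; [left|right]; first exact: supp_ge.
  by rewrite -dualN; exact: supp_ge.
have [N hN] := exists_large_nat B e0.
have [s sP] := approx_weights n (ler0n R N) lam0.
have := hc s; apply/negP; rewrite -ltNge.
apply: (@le_lt_trans _ _ (a * (size s)%:R + (B - N%:R * e))); last by lra.
apply: supp_le => // x Kx; rewrite dual_sum.
have -> : \sum_(i <- s) c i x = a * (size s)%:R + \sum_(i <- s) (c i x - a).
  rewrite big_split/= big_const_seq count_predT iter_addr_0 -mulr_natr; ring.
rewrite lerD2l (le_trans (sP _))// addrC lerD ?hB// -mulrN ler_wpM2l//.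
have : e <= l (\row_(i < n) (c i x - a)) by apply: lC; exists x.
suff -> : l (\row_(i < n) (c i x - a)) = - \sum_(i < n) lam i * (c i x - a) by lra.
rewrite [X in l X]row_sum_delta linear_sum/= -sumrN; apply: eq_bigr => i _.
by rewrite linearZ/= lamE mxE /GRing.scale/=; ring.
Qed.

(** Weak compactness passes from finitely many indices to all: the sets of points of [K] good for
    the first [n] indices are nested, closed and nonempty. *)
Lemma minimax K (c : nat -> norm_dual X) (a e : R) : cwk K -> 0 < e ->
  (forall s : seq nat, a * (size s)%:R <= supp (\sum_(i <- s) c i) K) ->
  exists2 x, K x & forall i, a - e <= c i x.
Proof.
move=> cK e0 hc.
pose C n : set (norm_weak_topology X) :=
  K `&` [set x | forall i, (i < n)%N -> a - e <= c i x].
have [x Cx] : exists x, forall n, C n x.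
  apply: nested_compact => [m n mn x [Kx h]|n|n|].
  - by split=> // i im; apply: h; exact: leq_trans mn.
  - apply: closedI; first exact: cwk_closed.
    rewrite (_ : [set _ | _] = \bigcap_(i in [set i | (i < n)%N])
      (fun x : norm_weak_topology X => c i x : R) @^-1` [set t | a - e <= t])//.
    apply: closed_bigI => i _; apply: preimage_closed.
      by move=> x _; exact: dual_weakly_continuous.
    exact: closed_ge.
  - by have [x Kx h] := minimax_finite n cK e0 hc; exists x.
  - have [_ _ kK] := cK; rewrite (_ : C 0%N = K)//.
    by apply/seteqP; split=> [x []|x Kx].
exists x; first by have [] := Cx 0%N.
by move=> i; have [_] := Cx i.+1; exact.
Qed.

End Representation.

(** * Sublinear functionals as support functions *)

Section SublinearRepresentation.
Context (R : realType) (X : normedModType R).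
Implicit Types (f g : norm_dual X).

Definition dominated_points (phi : norm_dual X -> R) : set X :=
  [set x | forall f, f x <= phi f].

Variable phi : norm_dual X -> R.
Hypothesis phi_sublinear : sublinear phi.
Hypothesis phi_eval : forall z : {linear norm_dual X -> R^o},
  (forall f, z f <= phi f) -> exists x, forall f, z f = f x.

(** Hahn-Banach yields a linear [z <= phi] touching [phi] at [f], and [z] is the evaluation at a
    point of the set. *)
Lemma supp_dominated_points f : supp f (dominated_points phi) = phi f.
Proof.
have [z [zphi zf]] := hahn_banach f phi_sublinear.
have [x zx] := phi_eval zphi.
have Wx : dominated_points phi x by move=> g; rewrite -zx.
apply/eqP; rewrite eq_le; apply/andP; split.
  by apply: supp_le => [|y]; [exists x|exact].
rewrite -zf zx; apply: ub_le_sup; last by exists x.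
by exists (phi f) => _ [y Wy <-]; exact: Wy.
Qed.

(** For compactness: along an ultrafilter on the set every [f x] stays between [- phi (- f)] and
    [phi f], hence converges. The limit is linear in [f] and below [phi], so it is the evaluation at
    a point, which is the weak limit. *)
Lemma cwk_dominated_points : cwk (dominated_points phi).
Proof.
split.
- have [z [zphi _]] := hahn_banach 0 phi_sublinear.
  by have [x zx] := phi_eval zphi; exists x => g; rewrite -zx.
- move=> x y t; rewrite !inE => Wx Wy f.
  rewrite -[conv _ _ _]/(t%:num *: x + (1 - t%:num) *: y) linearD !linearZ/=.
  have t0 : 0 <= t%:num by [].
  have t1 : 0 <= 1 - t%:num by rewrite subr_ge0.
  rewrite (@le_trans _ _ (t%:num * phi f + (1 - t%:num) * phi f))//.
    by rewrite lerD// ler_wpM2l.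
  by rewrite -mulrDl addrC subrK mul1r.
rewrite compact_ultra => F FU FW.
have FF : ProperFilter F by exact: ultra_proper.
have cvf f : exists l : R, (f x : R) @[x --> F] --> l.
  apply: (@ultra_bounded_cvg _ _ _ _ (- phi (- f)) (phi f)).
  apply: filterS FW => x Wx; apply/andP; split; last exact: Wx.
  by rewrite lerNl -dualN; exact: Wx.
have [z zP] := choice cvf.
have zlin : linear (z : norm_dual X -> R^o).
  move=> t f g; apply: (cvg_unique (@Rhausdorff R) (zP _)).
  have tf : (t * f x : R) @[x --> F] --> t * z f by apply: cvgM (zP f); exact: cvg_cst.
  exact: (cvgD tf (zP g)).
pose aux := GRing.isLinear.Build R (norm_dual X) R^o *:%R z zlin.
pose l : {linear norm_dual X -> R^o} := HB.pack (z : norm_dual X -> R^o) aux.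
have lphi f : l f <= phi f.
  by apply: (cvgr_to_le (zP f)); apply: filterS FW => x; exact.
have [x lx] := phi_eval lphi.
exists x; split; first by move=> f; rewrite -lx.
by apply: weak_cvg => f; rewrite -lx; exact: zP.
Qed.

End SublinearRepresentation.

(** * Grothendieck's criterion for evaluations *)

Section Grothendieck.
Context (R : realType) (X : normedModType R).
Implicit Types (f g : norm_dual X).

Definition dual_norm f : R := inf [set M | 0 <= M /\ forall x, `|f x| <= M * `|x|].

Lemma dual_norm_has_inf f : has_inf [set M | 0 <= M /\ forall x, `|f x| <= M * `|x|].
Proof.
split; last by exists 0 => M [].
have [M fM] := dual_bounded f; exists `|M|; split=> // x.
by rewrite (le_trans (fM x))// ler_wpM2r// ler_norm.
Qed.

Lemma dual_norm_le f M : 0 <= M -> (forall x, `|f x| <= M * `|x|) ->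
  dual_norm f <= M.
Proof. by move=> M0 fM; apply: ge_inf; [exact: (dual_norm_has_inf f).2|]. Qed.

Lemma dual_norm_ge0 f : 0 <= dual_norm f.
Proof. by apply: lb_le_inf => [|M []//]; exact: (dual_norm_has_inf f).1. Qed.

Lemma le_dual_norm f x : `|f x| <= dual_norm f * `|x|.
Proof.
have [->|x0] := eqVneq x 0; first by rewrite linear0 !normr0 mulr0.
rewrite -ler_pdivrMr ?normr_gt0//; apply: lb_le_inf => [|M [_ fM]].
  exact: (dual_norm_has_inf f).1.
by rewrite ler_pdivrMr ?normr_gt0.
Qed.

Lemma dual_norm_sublinear : sublinear dual_norm.
Proof.
apply: sublinearP => [|f g|t f t0].
- apply/eqP; rewrite eq_le dual_norm_ge0 andbT; apply: dual_norm_le => // x.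
  by rewrite normr0 mul0r.
- apply: dual_norm_le => [|x]; first by rewrite addr_ge0// dual_norm_ge0.
  by rewrite dualD (le_trans (ler_normD _ _))// mulrDl lerD// le_dual_norm.
- apply: dual_norm_le => [|x]; first by rewrite mulr_ge0 ?dual_norm_ge0 ?ltW.
  by rewrite dualZ normrM gtr0_norm// -mulrA ler_pM2l// le_dual_norm.
Qed.

(** By induction on [s]: subtracting a multiple of the evaluation at [a] makes [l] vanish on the
    annihilator of the remaining points. *)
Lemma linear_vanishing_eval (s : seq X) (l : {linear norm_dual X -> R^o}) :
  (forall f, (forall x, x \in s -> f x = 0) -> l f = 0) ->
  exists x, forall f, l f = f x.
Proof.
elim: s l => [|a s IHs] l ls.
  by exists 0 => f; rewrite linear0 ls.
(* If every [g] vanishing on [s] also vanishes at [a], the point [a] adds no constraint and is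
   dropped. *)
have [[g [gs ga]]|/forallNP hg] :=
  pselect (exists g, (forall x, x \in s -> g x = 0) /\ g a != 0); last first.
  apply: IHs => f fs; apply: ls => x; rewrite inE => /predU1P[->|/fs//].
  by apply: contrapT => fa; apply: (hg f); split=> //; apply/eqP.
pose r := l g / g a.
have h_lin : linear ((fun f => l f - r * f a) : norm_dual X -> R^o).
  move=> t f h /=; rewrite linearD linearZ/= ?dualD ?dualZ /GRing.scale/=; ring.
pose aux := GRing.isLinear.Build R (norm_dual X) R^o *:%R _ h_lin.
pose h : {linear norm_dual X -> R^o} :=
  HB.pack ((fun f => l f - r * f a) : norm_dual X -> R^o) aux.
have [|x hx] := IHs h.
  move=> f fs; rewrite /= [X in X - _](_ : _ = l (f - (f a / g a) *: g) + (f a / g a) * l g).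
    rewrite ls => [|x]; first by rewrite /r; ring.
    rewrite inE => /predU1P[->|xs]; rewrite dualB dualZ; last first.
      by rewrite (fs _ xs) (gs _ xs) mulr0 subrr.
    by rewrite divfK// subrr.
  by rewrite linearB linearZ/= /GRing.scale/=; ring.
exists (x + r *: a) => f; rewrite linearD linearZ/= -hx /=.
by rewrite /GRing.scale/=; ring.
Qed.

(* Extending the restriction of z to the annihilator of s with the bound
   e * dual_norm changes z by a functional vanishing on this annihilator, that is,
   by an evaluation. *)
Lemma approx_eval (z : {linear norm_dual X -> R^o}) (e : R) (s : seq X) : 0 < e ->
  (forall f, (forall x, `|f x| <= `|x|) -> (forall x, x \in s -> f x = 0) -> z f <= e) ->
  exists x, forall f, z f - f x <= e * dual_norm f.
Proof.
move=> e0 zs.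
pose p f := e * dual_norm f.
have [nD nZ] := dual_norm_sublinear.
have hp : sublinear p.
  split=> [f g|t f t0]; first by rewrite /p -mulrDr ler_wpM2l// ltW.
  by rewrite /p nZ//; ring.
pose S : set (norm_dual X * R) :=
  [set fa : norm_dual X * R | (forall x, x \in s -> fa.1 x = 0) /\ fa.2 = z fa.1].
have hS : cone S.
  split=> [|[f a] [g b] [fs /= ->] [gs /= ->]|t [f a] t0 [fs /= ->]].
  - by split=> //=; rewrite linear0.
  - by split=> [x xs|/=]; rewrite ?dualD ?fs ?gs ?addr0// linearD.
  - by split=> [x xs|/=]; rewrite ?dualZ ?fs ?mulr0// linearZ.
have Sp fa : S fa -> fa.2 <= p fa.1.
  move: fa => [f a] [/= fs ->]; apply/ler_addgt0Pr => d d0.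
  (* The term [d / e] keeps the normalising constant positive when [dual_norm f] is zero, and costs
     only [d] in the bound. *)
  pose M := dual_norm f + d / e.
  have M0 : 0 < M by rewrite ltr_wpDl ?dual_norm_ge0// divr_gt0.
  have : z (M^-1 *: f) <= e.
    apply: zs => x; last by move=> xs; rewrite dualZ fs// mulr0.
    rewrite dualZ normrM gtr0_norm ?invr_gt0// ler_pdivrMl//.
    by rewrite (le_trans (le_dual_norm _ _))// ler_wpM2r// lerDl divr_ge0// ltW.
  rewrite linearZ/= /GRing.scale/= ler_pdivrMl// => /le_trans; apply.
  by rewrite /M /p mulrDl divfK ?gt_eqF// mulrC.
have [l [lp lS]] := sandwich hp hS Sp.
pose h : {linear norm_dual X -> R^o} := z \- l.
have [|x hx] := @linear_vanishing_eval s h.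
  move=> f fs; have := lS (f, z f) (conj fs erefl).
  have := lS (- f, z (- f)); rewrite /= !linearN => h1 h2.
  have {}h1 : - z f <= - l f.
    apply: h1; split; last by rewrite /= linearN.
    by move=> x xs; rewrite /= fs// oppr0.
  by apply/eqP; rewrite subr_eq0 eq_le h2/= -lerN2.
exists x => f; rewrite -hx /= opprB addrC subrK; exact: lp.
Qed.

End Grothendieck.

(** By [approx_eval] there are points [u n] whose evaluations are within [1 / (n + 1)] of [z] in
    dual norm. Norming functionals turn this into a Cauchy estimate, and completeness of [X] gives
    the point. *)
Theorem grothendieck_eval (R : realType) (X : completeNormedModType R)
    (z : {linear norm_dual X -> R^o}) :
  (forall e, 0 < e -> exists s : seq X, forall f : norm_dual X,
     (forall x, `|f x| <= `|x|) -> (forall x, x \in s -> f x = 0) -> z f <= e) ->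
  exists x, forall f, z f = f x.
Proof.
move=> hz.
have /choice[u uP] (n : nat) : exists x, forall f, z f - f x <= n.+1%:R^-1 * dual_norm f.
  have n0 : (0 : R) < n.+1%:R^-1 by rewrite invr_gt0.
  have [s zs] := hz _ n0.
  exact: approx_eval zs.
have uP' n f : `|z f - f (u n)| <= n.+1%:R^-1 * dual_norm f.
  rewrite ler_norml uP andbT lerNl.
  have := uP n (- f); rewrite linearN dualN -opprD => /le_trans; apply.
  rewrite ler_wpM2l ?invr_ge0// dual_norm_le ?dual_norm_ge0// => x.
  by rewrite dualN normrN le_dual_norm.
have uB m n : `|u m - u n| <= m.+1%:R^-1 + n.+1%:R^-1.
  have [f [fb <-]] := norming_functional (u m - u n).
  have f1 : dual_norm f <= 1 by apply: dual_norm_le => // x; rewrite mul1r.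
  have fu k : `|z f - f (u k)| <= k.+1%:R^-1.
    by rewrite (le_trans (uP' k f))// ler_piMr.
  have := fu m; have := fu n; rewrite !ler_norml linearB/= => /andP[_ h1] /andP[h2 _].
  by have := lerB h1 h2; rewrite opprK opprB addrC addrA subrK [leRHS]addrC.
have small (e : R) : 0 < e -> \forall n \near \oo, n.+1%:R^-1 < e.
  by move=> e0; exact: near_infty_natSinv_lt (PosNum e0).
have cu : cauchy (u @ \oo).
  apply: cauchy_exP => e e0.
  have e20 : 0 < e / 2 by rewrite divr_gt0.
  have [N _ hN] := small _ e20.
  exists (u N); exists N => // n Nn; rewrite -ball_normE /=.
  rewrite (le_lt_trans (uB _ _))// [ltRHS]splitr ltrD//; apply: hN => //=.
have /cvg_ex[x ux] : cvg (u @ \oo) by exact: cauchy_cvg.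
exists x => f; have /continuous_dual_bounded fc := dual_bounded f.
have fux : f (u n) @[n --> \oo] --> f x by apply: continuous_cvg; [exact: fc|].
apply: (cvg_unique (@Rhausdorff R) _ fux).
apply/cvgrPdist_lt => e e0; have d0 : 0 < dual_norm f + 1 by rewrite ltr_wpDl ?dual_norm_ge0.
near=> n; rewrite (le_lt_trans (uP' n f))//.
rewrite (@le_lt_trans _ _ (n.+1%:R^-1 * (dual_norm f + 1)))//.
  by rewrite ler_wpM2l// lerDl.
rewrite -ltr_pdivlMr//; near: n; apply: small; exact: divr_gt0.
Unshelve. all: by end_near. Qed.

(** * Hahn-Banach relative to a subspace *)

Section SandwichOn.
Context (R : realType) (V : lmodType R) (U : submodClosed V).

Let sub := {v : V | v \in U}.
HB.instance Definition _ := SubType.on sub.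
HB.instance Definition _ := [Choice of sub by <:].
HB.instance Definition _ := [SubChoice_isSubLmodule of sub by <:].

(** This is meant for the upper integral, whose sublinearity is established on the subspace of
    dominated functions. *)
Lemma sandwich_convex_on (p : V -> R) (C : set V) (a : R) :
  (forall u v, u \in U -> v \in U -> p (u + v) <= p u + p v) ->
  (forall t v, 0 < t -> v \in U -> p (t *: v) <= t * p v) -> p 0 = 0 ->
  convex C -> C !=set0 -> (forall c, C c -> c \in U /\ a <= p c) ->
  exists l : V -> R, [/\
    (forall t u v, u \in U -> v \in U -> l (t *: u + v) = t * l u + l v),
    (forall v, v \in U -> l v <= p v) & (forall c, C c -> a <= l c)].
Proof.
move=> pD pZ p0 cC [c0 Cc0] Cp.
have hp : sublinear (fun v : sub => p (val v)).
  by apply: sublinearP => [|u v|t v t0]; rewrite ?pD ?pZ//; exact: valP.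
have cC' : convex [set v : sub | C (val v)].
  by move=> x y t t01 Cx Cy; exact: cC.
have C0' : [set v : sub | C (val v)] !=set0 by exists (Sub c0 (Cp _ Cc0).1).
have Cp' (c : sub) : C (val c) -> a <= p (val c) by move=> /Cp[].
have [l [lp lC]] := sandwich_convex hp cC' C0' Cp'.
pose l' v := if insub v is Some u then l (u : sub) else 0.
have l'E (v : sub) : l' (val v) = l v by rewrite /l' valK.
exists l'; split=> [t u v uU vU|v vU|c Cc].
- rewrite -[u]/(val (Sub u uU : sub)) -[v]/(val (Sub v vU : sub)).
  by rewrite -linearZ -linearD !l'E linearD linearZ.
- by rewrite -[v]/(val (Sub v vU : sub)) l'E lp.
- by rewrite -[c]/(val (Sub c (Cp _ Cc).1 : sub)) l'E; apply: lC.
Qed.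

End SandwichOn.

(** * Functions dominated by a fixed function *)

Section DominatedFunctions.
Context (R : realType) (T : Type) (E : set T) (h : T -> R).

Definition dominated : {pred T -> R^o} :=
  fun F => `[< exists C, forall x, E x -> `|F x| <= C * h x >].

Lemma dominated_submod : submod_closed dominated.
Proof.
split=> [|t F G /asboolP[C FC] /asboolP[D GD]].
  by apply/asboolP; exists 0 => x _; rewrite normr0 mul0r.
apply/asboolP; exists (`|t| * C + D) => x Ex.
rewrite (le_trans (ler_normD _ _))// mulrDl lerD ?GD//.
by rewrite normrM -mulrA ler_wpM2l// FC.
Qed.

HB.instance Definition _ :=
  GRing.isSubmodClosed.Build R (T -> R^o) dominated dominated_submod.

Lemma dominatedP (F : T -> R) :
  reflect (exists C, forall x, E x -> `|F x| <= C * h x) ((F : T -> R^o) \in dominated).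
Proof. exact: asboolP. Qed.

End DominatedFunctions.

(** * Minimising a quadratic form over the tails of a convex hull *)

Section QuadraticMinimisation.
Context (R : realType) (T : Type) (E : set T) (h : T -> R).
Hypothesis h0 : forall x, E x -> 0 <= h x.
Local Notation U := (@dominated R T E h).

Variable L : (T -> R^o) -> R.
Hypothesis L_linear : forall t F G, F \in U -> G \in U -> L (t *: F + G) = t * L F + L G.
Hypothesis L_pos : forall F : T -> R, (F : T -> R^o) \in U ->
  (forall x, E x -> F x <= 0) -> L F <= 0.

Context (W : lmodType R) (ev : T -> {linear W -> R^o}).
Variable g : nat -> W.
Hypothesis gh : forall k x, E x -> `|ev x (g k)| <= h x.

Definition tail_hull (j : nat) : set W := hull [set g k | k in [set k | (j <= k)%N]].

Lemma tail_hull_le i j : (i <= j)%N -> tail_hull j `<=` tail_hull i.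
Proof.
move=> ij; apply: hull_min => [|_ [k /= jk <-]]; first exact: hull_convex.
by apply: hull_in; exists k => //; exact: leq_trans jk.
Qed.

Let L0 : L 0 = 0.
Proof.
by have := L_linear 1 (rpred0 U) (rpred0 U); rewrite scaler0 addr0 mul1r; lra.
Qed.

Let LD F G : F \in U -> G \in U -> L (F + G) = L F + L G.
Proof. by move=> FU GU; rewrite -[F in F + _]scale1r L_linear// mul1r. Qed.

Let LZ t F : F \in U -> L (t *: F) = t * L F.
Proof. by move=> FU; rewrite -[t *: F]addr0 L_linear ?rpred0// L0 addr0. Qed.

Let LB F G : F \in U -> G \in U -> L (F - G) = L F - L G.
Proof. by move=> FU GU; rewrite LD ?rpredN// -scaleN1r LZ// mulN1r. Qed.

Lemma L_le (F G : T -> R) : (F : T -> R^o) \in U -> (G : T -> R^o) \in U ->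
  (forall x, E x -> F x <= G x) -> L F <= L G.
Proof.
move=> FU GU FG; rewrite -subr_le0 -LB//; apply: L_pos; first exact: rpredB.
by move=> x Ex; rewrite [X in X <= _]/(F x - G x) subr_le0 FG.
Qed.

Let hU : (h : T -> R^o) \in U.
Proof. by apply/dominatedP; exists 1 => x /h0 hx; rewrite mul1r ger0_norm. Qed.

Let half01 : 0 <= (1 / 2 : R) <= 1.
Proof. by apply/andP; split; lra. Qed.

Lemma ev_hull j c x : tail_hull j c -> E x -> `|ev x c| <= h x.
Proof.
move=> jc Ex; move: c jc; apply: hull_min => [u v t /andP[t0 t1] uh vh|_ [k _ <-]].
  have t1' : 0 <= 1 - t by rewrite subr_ge0.
  rewrite /mkset linearD !linearZ/= (le_trans (ler_normD _ _))// !normrM.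
  rewrite (ger0_norm t0) (ger0_norm t1').
  by have := ler_wpM2l t0 uh; have := ler_wpM2l t1' vh; lra.
exact: gh.
Qed.

(** As the inverse of 0 is 0, [sq c] vanishes where [h] does; nothing is lost, since on [E] a [c] in
    the hull has [ev x c = 0] there. *)
Let sq (c : W) (x : T) : R := ev x c ^+ 2 / h x.
Let Q c := L (sq c).

Let bound_sq c C : 0 <= C -> (forall x, E x -> `|ev x c| <= C * h x) ->
  forall x, E x -> 0 <= sq c x <= C ^+ 2 * h x.
Proof.
move=> C0 cC x Ex; have hx := h0 Ex.
rewrite divr_ge0 ?sqr_ge0//=.
have := cC x Ex; rewrite /sq; have [->|hx0] := eqVneq (h x) 0.
  by rewrite !mulr0 invr0 mulr0.
rewrite ler_pdivrMr ?lt0r ?hx0//.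
rewrite -real_normK ?num_real// (_ : C ^+ 2 * h x * h x = (C * h x) ^+ 2); last by ring.
by apply: lerXn2r; rewrite nnegrE// mulr_ge0.
Qed.

Let sqU c C : 0 <= C -> (forall x, E x -> `|ev x c| <= C * h x) ->
  (sq c : T -> R^o) \in U.
Proof.
move=> C0 cC; apply/dominatedP; exists (C ^+ 2) => x Ex.
by have /andP[s0 s1] := bound_sq C0 cC Ex; rewrite ger0_norm.
Qed.

Let hull_bound j c : tail_hull j c -> forall x, E x -> `|ev x c| <= 1 * h x.
Proof. by move=> jc x Ex; rewrite mul1r; exact: ev_hull jc Ex. Qed.

Let Q_bound j c : tail_hull j c -> 0 <= Q c <= L h.
Proof.
move=> /hull_bound cb; have cU := sqU ler01 cb.
apply/andP; split.
  rewrite -L0; apply: L_le => //; first exact: rpred0.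
  by move=> x Ex; have /andP[] := bound_sq ler01 cb Ex.
apply: L_le => // x Ex.
by have /andP[_] := bound_sq ler01 cb Ex; rewrite expr1n mul1r.
Qed.

(** The midpoint is written as a convex combination so that convexity of the hull applies to it
    directly. *)
Let Q_parallelogram i j c d : tail_hull i c -> tail_hull j d ->
  Q (c - d) = 2 * Q c + 2 * Q d - 4 * Q ((1 / 2) *: c + (1 - 1 / 2) *: d).
Proof.
move=> ic jd; have cb := hull_bound ic; have db := hull_bound jd.
have mb : forall x, E x -> `|ev x ((1 / 2) *: c + (1 - 1 / 2) *: d)| <= 1 * h x.
  have c0 := tail_hull_le (leq0n i) ic; have d0 := tail_hull_le (leq0n j) jd.
  by apply: (@hull_bound 0%N); apply: hull_convex => //; exact: half01.
have E1 : (sq (c - d) : T -> R^o) = 2 *: (sq c : T -> R^o) + 2 *: (sq d : T -> R^o)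
    - 4 *: (sq ((1 / 2) *: c + (1 - 1 / 2) *: d) : T -> R^o).
  apply/funext => x.
  rewrite -[RHS]/(2 * sq c x + 2 * sq d x - 4 * sq ((1 / 2) *: c + (1 - 1 / 2) *: d) x).
  have mE : ev x ((1 / 2) *: c + (1 - 1 / 2) *: d) = 1 / 2 * ev x c + (1 - 1 / 2) * ev x d.
    by rewrite linearD !linearZ.
  rewrite /sq linearB mE.
  have aux (H a b : R) : (a - b) ^+ 2 * H = 2 * (a ^+ 2 * H) + 2 * (b ^+ 2 * H) -
      4 * ((1 / 2 * a + (1 - 1 / 2) * b) ^+ 2 * H) by field.
  exact: aux.
have cU := sqU ler01 cb; have dU := sqU ler01 db; have mU := sqU ler01 mb.
by rewrite /Q E1 LB ?rpredD ?rpredZ// LD ?rpredZ// !LZ.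
Qed.

(** The infima of [Q] over the tails increase with the index and are at most [L h]; [I] is their
    supremum. *)
Let near_minimal : exists I : R, forall (n : nat) (e : R), 0 < e ->
  exists mc : nat * W, [/\ (n <= mc.1)%N, tail_hull mc.1 mc.2, Q mc.2 < I + e &
    forall c, tail_hull mc.1 c -> I - e < Q c].
Proof.
pose m j := inf [set Q c | c in tail_hull j].
have hm j : has_inf [set Q c | c in tail_hull j].
  split; last by exists 0 => _ [c /Q_bound/andP[? _] <-].
  by exists (Q (g j)), (g j) => //; apply: hull_in; exists j => /=.
have mle j c : tail_hull j c -> m j <= Q c.
  by move=> jc; apply: ge_inf; [exact: (hm j).2|exists c].
have hM : has_sup [set m j | j in setT].
  split; first by exists (m 0%N), 0%N.
  exists (L h) => _ [j _ <-]; have jg : tail_hull j (g j) by apply: hull_in; exists j => /=.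
  by rewrite (le_trans (mle _ _ jg))//; have /andP[] := Q_bound jg.
exists (sup [set m j | j in setT]) => n e e0.
have [_ [j _ <-] Ij] := sup_adherent e0 hM.
have mono i k : (i <= k)%N -> m i <= m k.
  move=> ik; apply: lb_le_inf; first exact: (hm k).1.
  by move=> _ [c kc <-]; apply: mle; exact: tail_hull_le kc.
pose k := maxn n j.
have [_ [c kc <-] Qc] := inf_adherent e0 (hm k).
exists (k, c); split; rewrite /= ?leq_maxl//.
  rewrite (lt_le_trans Qc)// lerD2r; apply: ub_le_sup; first exact: hM.2.
  by exists k.
move=> d kd; rewrite (lt_le_trans Ij)// (le_trans _ (mle _ _ kd))//.
by apply: mono; rewrite leq_maxr.
Qed.

(* Minimising the quadratic form c |-> L (c ^ 2 / h) over the tails of the sequence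
   yields convex combinations whose successive differences are small. *)
Lemma almost_stationary_hull (e : nat -> R) : (forall j, 0 < e j) ->
  (forall j, e j.+1 <= e j) ->
  exists c : nat -> W, forall j, tail_hull j (c j) /\
    L (fun x => `|ev x (c j - c j.+1)|) <= e j.
Proof.
move=> e0 edec; have [I hI] := near_minimal.
have Lh0 : 0 <= L h by rewrite -L0; apply: L_le => //; exact: rpred0.
(* Adding 1 makes [K] positive even if [L h] is zero; [eta] is calibrated so that the bound [h2]
   below comes out as [e j / 2]. *)
pose K := L h + 1; have K0 : 0 < K by rewrite ltr_wpDl.
pose eta j := e j ^+ 2 / (8 * K).
have eta0 j : 0 < eta j by rewrite divr_gt0 ?exprn_gt0 ?mulr_gt0.
have etadec j : eta j.+1 <= eta j.
  rewrite ler_wpM2r ?invr_ge0 ?mulr_ge0 ?(ltW K0)//.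
  by apply: lerXn2r; rewrite ?nnegrE ?(ltW (e0 _)).
have /choice[mc mcP] (j : nat) := hI j _ (eta0 j).
exists (fun j => (mc j).2) => j; have [jm jc Qc Ic] := mcP j.
split; first exact: tail_hull_le jc.
have [jm' jc' Qc' Ic'] := mcP j.+1.
set c := (mc j).2 in jc Qc *; set d := (mc j.+1).2 in jc' Qc' *.
(* The midpoint lies in the larger of the two tails, whose lower bound applies; the parallelogram
   identity then makes [Q (c - d)] small. *)
have Qmid : I - eta j < Q ((1 / 2) *: c + (1 - 1 / 2) *: d).
  have half := half01.
  have /orP[mm|mm] := leq_total (mc j).1 (mc j.+1).1.
    by apply: Ic; apply: hull_convex => //; exact: tail_hull_le jc'.
  apply: le_lt_trans (Ic' _ _); first by rewrite lerB.
  by apply: hull_convex => //; exact: tail_hull_le jc.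
have Qcd : Q (c - d) <= 8 * eta j.
  by rewrite (Q_parallelogram jc jc'); have := etadec j; lra.
have cdb x : E x -> `|ev x (c - d)| <= 2 * h x.
  move=> Ex; rewrite linearB (le_trans (ler_normB _ _))// mulrDl mul1r.
  by rewrite lerD// ?(ev_hull jc)// (ev_hull jc').
(* Young's inequality [y <= (s / 2) * h + y ^ 2 / (2 * s * h)] trades the absolute value for the
   quadratic form; with this [s] each term contributes at most [e j / 2]. *)
pose s := e j / K; have s0 : 0 < s by rewrite divr_gt0.
have cdU := sqU (ler0n R 2) cdb.
rewrite (@le_trans _ _ (L ((s / 2) *: (h : T -> R^o) +
    (1 / (2 * s)) *: (sq (c - d) : T -> R^o))))//.
  apply: L_le.
  - by apply/dominatedP; exists 2 => x Ex; rewrite normr_id; exact: cdb.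
  - by rewrite rpredD ?rpredZ.
  move=> x Ex; rewrite -[leRHS]/(s / 2 * h x + 1 / (2 * s) * (ev x (c - d) ^+ 2 / h x)).
  have := cdb x Ex; have := h0 Ex; set b := ev x (c - d).
  rewrite le_eqVlt => /predU1P[<-|hx].
    by rewrite mulr0 normr_le0 => /eqP ->; rewrite normr0 invr0 !mulr0 addr0.
  move=> _; rewrite -[in b ^+ 2]real_normK ?num_real//; set y := `|b|.
  rewrite -subr_ge0.
  have -> : s / 2 * h x + 1 / (2 * s) * (y ^+ 2 / h x) - y =
      (s * h x - y) ^+ 2 / (2 * s * h x).
    by field; rewrite ?gt_eqF.
  apply: divr_ge0; first exact: sqr_ge0.
  by apply: mulr_ge0; [apply: mulr_ge0; [exact: ler0n|exact: ltW]|exact: ltW].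
rewrite LD ?rpredZ// !LZ//.
have h1 : s / 2 * L h <= e j / 2.
  rewrite /s mulrAC ler_pM2r// -mulrA ler_piMr ?(ltW (e0 j))//.
  by rewrite mulrC ler_pdivrMr// mul1r lerDl.
have h2 : 1 / (2 * s) * Q (c - d) <= e j / 2.
  rewrite (@le_trans _ _ (1 / (2 * s) * (8 * eta j)))//.
    by rewrite ler_wpM2l// divr_ge0// mulr_ge0// ltW.
  rewrite le_eqVlt; apply/orP; left; apply/eqP; rewrite /s /eta.
  by field; rewrite !gt_eqF.
by rewrite [leRHS]splitr lerD.
Qed.

End QuadraticMinimisation.

(** * Mazur's lemma and domination in L1 *)

(** If the hull stayed at distance [e] from [h], some linear functional below [p] would be at least
    [e] on [S - h]. Symmetry of [p] makes it bounded, hence weakly continuous, which contradicts the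
    choice of [h] in the weak closure. *)
Lemma mazur (R : realType) (V : lmodType R) (p : V -> R) (S : set V) (h : V) (e : R) :
  sublinear p -> (forall v, p (- v) = p v) ->
  closure (S : set (weak_topology p)) h -> 0 < e ->
  exists2 c, hull S c & p (c - h) < e.
Proof.
move=> hp pN Sh e0; apply: contrapT => hS.
have {}hS c : hull S c -> e <= p (c - h).
  by move=> Sc; rewrite leNgt; apply/negP => ch; apply: hS; exists c.
pose C := [set c - h | c in hull S].
have cC : convex C.
  move=> _ _ t t01 [c Sc <-] [d Sd <-]; exists (t *: c + (1 - t) *: d).
    exact: hull_convex.
  by rewrite !scalerBr addrACA -opprD -scalerDl [t + _]addrC subrK scale1r.
have C0 : C !=set0.
  have [s [Ss _]] := Sh setT filterT.
  by exists (s - h), s => //; exact: hull_in.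
have Cp c : C c -> e <= p c by move=> [d Sd <-]; exact: hS.
have [l [lp lC]] := sandwich_convex hp cC C0 Cp.
have lN v : `|l v| <= 1 * p v.
  by rewrite mul1r ler_norml lp lerNl -linearN (le_trans (lp _))// pN.
have [f fl] := dual_intro (linearP l) lN.
have [v [Sv]] := Sh _ (dual_weakly_continuous (f := f) (nbhsx_ballx (f h : R) e e0)).
rewrite /= -ball_normE /= distrC -linearB fl; apply/negP; rewrite -leNgt.
rewrite (le_trans _ (ler_norm _))//; apply: lC; exists v => //; exact: hull_in.
Qed.

Section Domination.
Context (d : measure_display) (Omega : measurableType d) (R : realType).
Context (mu : {measure set Omega -> \bar R}).
Implicit Types u v : @L1 d Omega R mu.

Lemma L1_seminorm_sublinear : sublinear (@L1_seminorm d Omega R mu).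
Proof.
apply: sublinearP => [|u v|t v t0].
- rewrite /L1_seminorm (_ : 'N[mu]_1[_]%E = 0%E)// Lnorm1.
  by rewrite integral0_eq// => x _ /=; rewrite normr0.
- exact: ler_LnormD.
- rewrite /L1_seminorm (_ : 'N[mu]_1[EFin \o (t *: v)]%E = (`|t|%:E * 'N[mu]_1[EFin \o v])%E).
    by rewrite fineM//= ?gtr0_norm// -(finite_norm_fine v).
  exact: LnormZ.
Qed.

Lemma L1_seminormN u : L1_seminorm (- u) = L1_seminorm u.
Proof. exact: LnormrN. Qed.

Lemma L1_integrable u : mu.-integrable setT (EFin \o u).
Proof. exact/Lfun1_integrable/LfunP. Qed.

Lemma L1_seminormE u : (L1_seminorm u)%:E = (\int[mu]_w `|u w|%:E)%E.
Proof. by rewrite /L1_seminorm finite_norm_fine Lnorm1. Qed.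

(** The dominating function is [|h| + \sum_n |u n - h|], integrable by the geometric rate. *)
Lemma L1_fast_domination (h : L1 mu) (u : nat -> L1 mu) :
  (forall n, L1_seminorm (u n - h) <= 1 / (2 ^ n.+1)%:R) ->
  exists H : Omega -> R, [/\ mu.-integrable setT (EFin \o H), (forall w, 0 <= H w) &
    forall n, \forall w \ae mu, `|u n w| <= H w].
Proof.
move=> hu.
pose D (n : nat) (w : Omega) : R := `|u n w - h w|.
have D0 n w : (0 <= (D n w)%:E)%E by rewrite lee_fin; exact: normr_ge0.
pose S (w : Omega) : \bar R := (\sum_(n <oo) (D n w)%:E)%E.
have mD n : measurable_fun setT (fun w => (D n w)%:E).
  by apply/measurable_EFinP; apply: measurableT_comp => //; exact: measurable_funB.
have iS : mu.-integrable setT S.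
  apply/integrableP; split.
    by exact: ge0_emeasurable_sum.
  rewrite (eq_integral S); last first.
    by move=> w _; rewrite gee0_abs// nneseries_ge0.
  rewrite integral_nneseries//.
  apply: (@le_lt_trans _ _ 1%:E); last exact: ltry.
  apply: le_trans (@epsilon_trick0 R 1 xpredT ler01).
  apply: lee_nneseries => [n _ _|n _]; first exact: integral_ge0.
  by rewrite -[X in (X <= _)%E](L1_seminormE (u n - h)) lee_fin.
pose Hb (w : Omega) : \bar R := (`|h w|%:E + S w)%E.
have iH : mu.-integrable setT Hb.
  by apply: integrableD => //; exact: integrable_norm (L1_integrable h).
have Hb0 w : (0 <= Hb w)%E.
  by rewrite adde_ge0// ?lee_fin// nneseries_ge0.
(* [fine] sends infinite values to 0, so the bound is obtained where [Hb] is finite, that is almost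
   everywhere. *)
exists (fine \o Hb); split => [|w|n].
- apply: (le_integrable measurableT _ _ iH) => //.
    apply/measurable_EFinP; apply: measurableT_comp => //.
    by case/integrableP : iH.
  move=> w _ /=; rewrite [in leRHS]gee0_abs//.
  rewrite ger0_norm ?fine_ge0//.
  by case: (Hb w) (Hb0 w) => //= r; rewrite leey.
- exact: fine_ge0.
have := integrable_ae measurableT iH; apply: filterS => w /(_ I) Hw.
rewrite -lee_fin /= fineK//.
rewrite (@le_trans _ _ (`|h w|%:E + `|u n w - h w|%:E)%E)//.
  by rewrite -EFinD lee_fin -{1}[u n w](subrK (h w)) addrC ler_normD.
rewrite leeD2l// /S (@nneseriesD1 _ (fun k => (D k w)%:E) n xpredT)//.
by rewrite leeDl// nneseries_ge0.
Qed.

End Domination.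

Section SupportDomination.
Context (d : measure_display) (Omega : measurableType d) (R : realType).
Context (mu : {measure set Omega -> \bar R}) (X : normedModType R).
Variable (G : Omega -> set X).
Hypothesis cG : forall w, cwk (G w).
Hypothesis iG : scalarly_integrable mu G.
Hypothesis hT : weakly_compact_op (supp_op iG).
Implicit Types f g : nat -> norm_dual X.

Lemma tail_hull_bounded f k c : (forall n x, `|f n x| <= `|x|) ->
  tail_hull f k c -> forall x, `|c x| <= `|x|.
Proof.
move=> fb kc x; rewrite -[c x]/(c x : R).
move: c kc; apply: hull_min => [u v t /andP[t0 t1] ux vx|_ [n _ <-]]; last exact: fb.
have t1' : 0 <= 1 - t by rewrite subr_ge0.
rewrite /mkset dualD !dualZ (le_trans (ler_normD _ _))// !normrM.
rewrite (ger0_norm t0) (ger0_norm t1').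
by have := ler_wpM2l t0 ux; have := ler_wpM2l t1' vx; lra.
Qed.

(** A weak cluster point of the sequence [supp_op iG (f n)] exists by relative weak compactness and
    is adherent to every tail. *)
Lemma tail_hull_weak_closure f : (forall n x, `|f n x| <= `|x|) ->
  exists h : weak_topology (@L1_seminorm d Omega R mu), forall k,
    closure ([set supp_op iG (f i) | i in [set i | (k <= i)%N]] :
      set (weak_topology (@L1_seminorm d Omega R mu))) h.
Proof.
move=> fb; pose B : set (norm_dual X) := [set c | forall x, `|c x| <= 1 * `|x|].
have /hT : dual_bounded_set B by exists 1 => c.
rewrite precompactE => cB.
pose F : set_system (weak_topology (@L1_seminorm d Omega R mu)) :=
  (fun n => supp_op iG (f n)) @ \oo.
have FF : ProperFilter F by exact: fmap_proper_filter.
have FB : F (closure (supp_op iG @` B : set (weak_topology (@L1_seminorm d Omega R mu)))).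
  exists 0%N => // n _; apply: subset_closure; exists (f n) => //.
  by move=> x; rewrite mul1r.
have [h [_ Fh]] := cB F FF FB.
exists h => k A hA; apply: Fh => //.
by exists k => // n /= kn; exists n.
Qed.

(** Mazur's lemma combines the functions [supp_op iG (f i)]; by sublinearity, the same combination
    of the functionals [f i] has a support function below the result. *)
Lemma hull_supp_le f k (c : @L1 d Omega R mu) :
  hull [set supp_op iG (f i) | i in [set i | (k <= i)%N]] c ->
  exists g : norm_dual X, tail_hull f k g /\ forall w, supp g (G w) <= c w.
Proof.
move: c; apply: hull_min => [u v t t01 [a [ka au]] [b [kb bv]]|_ [i ki <-]].
  exists (t *: a + (1 - t) *: b); split; first exact: hull_convex.
  move=> w; have [sD sZ] := supp_sublinear (cG w).
  have [t0 t1] := andP t01.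
  rewrite (le_trans (sD _ _))// !sZ ?subr_ge0//.
  by apply: lerD; rewrite ler_wpM2l ?subr_ge0.
by exists (f i); split => //; apply: hull_in; exists i.
Qed.

Lemma supp_domination f : (forall n x, `|f n x| <= `|x|) ->
  exists g (H : Omega -> R), [/\ forall k, tail_hull f k (g k),
    mu.-integrable setT (EFin \o H), forall w, 0 <= H w &
    forall k, \forall w \ae mu, supp (g k) (G w) <= H w].
Proof.
move=> fb; have [h hh] := tail_hull_weak_closure fb.
have /choice[cg cgP] (k : nat) : exists cg : @L1 d Omega R mu * norm_dual X,
    [/\ L1_seminorm (cg.1 - h) <= 1 / (2 ^ k.+1)%:R, tail_hull f k cg.2 &
        forall w, supp cg.2 (G w) <= cg.1 w].
  have e0 : 0 < (1 / (2 ^ k.+1)%:R : R) by rewrite divr_gt0// ltr0n expn_gt0.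
  have [c kc ce] := mazur (@L1_seminorm_sublinear _ _ _ mu) (@L1_seminormN _ _ _ mu) (hh k) e0.
  have [g [kg gc]] := hull_supp_le kc.
  by exists (c, g); split => //; exact: ltW.
have [|H [iH H0 cH]] := @L1_fast_domination _ _ _ mu h (fun k => (cg k).1).
  by move=> k; have [] := cgP k.
exists (fun k => (cg k).2), H; split => // k; first by have [] := cgP k.
have := cH k; apply: filterS => w; apply: le_trans.
by have [_ _ /(_ w)] := cgP k; move=> /le_trans; apply; exact: ler_norm.
Qed.

Lemma tail_hullN f (g : norm_dual X) k : tail_hull (fun i => - f i) k g -> tail_hull f k (- g).
Proof.
move: g; apply: hull_min => [u v t t01 ku kv|_ [i ki <-]].
  by rewrite /mkset opprD -!scalerN; exact: hull_convex.
by rewrite /mkset opprK; apply: hull_in; exists i.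
Qed.

Lemma tail_hull_trans f g k : (forall i, tail_hull f i (g i)) ->
  tail_hull g k `<=` tail_hull f k.
Proof.
move=> fg; apply: hull_min => [|_ [i ki <-]]; first exact: hull_convex.
exact: tail_hull_le (fg i).
Qed.

(** [supp_domination] bounds [g k x] from above. Applied again to the negatives of the first
    combinations it gives a bound from below, and the upper bound survives because it is stable
    under convex combinations. *)
Lemma eval_domination f : (forall n x, `|f n x| <= `|x|) ->
  exists g (H : Omega -> R), [/\ forall k, tail_hull f k (g k),
    mu.-integrable setT (EFin \o H), forall w, 0 <= H w &
    \forall w \ae mu, forall k x, G w x -> `|g k x| <= H w].
Proof.
move=> fb; have [g1 [H1 [fg1 iH1 H10 gH1]]] := supp_domination fb.
have gb1 n x : `|(- g1 n) x| <= `|x|.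
  by rewrite dualN normrN; exact: tail_hull_bounded fb (fg1 n) _.
have [g2 [H2 [gg2 iH2 H20 gH2]]] := supp_domination gb1.
exists (fun k => - g2 k), (fun w => H1 w + H2 w); split.
- by move=> k; apply: (tail_hull_trans fg1); exact: tail_hullN.
- exact: (integrableD measurableT iH1 iH2).
- by move=> w; exact: addr_ge0.
have /ae_foralln h1 := gH1; have /ae_foralln h2 := gH2.
apply: filterS2 h1 h2 => w h1 h2 k x Gx.
have gk : supp (- g2 k) (G w) <= H1 w.
  have := tail_hullN (gg2 k); move: (- g2 k).
  have [sD sZ] := supp_sublinear (cG w).
  apply: hull_min => [u v t /andP[t0 t1] ux vx|_ [n _ <-]]; last exact: h1.
  have t1' : 0 <= 1 - t by rewrite subr_ge0.
  rewrite /mkset (le_trans (sD _ _))// !sZ//.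
  by have := ler_wpM2l t0 ux; have := ler_wpM2l t1' vx; lra.
have := le_trans (supp_ge (- g2 k) (cG w) Gx) gk.
have := le_trans (supp_ge (g2 k) (cG w) Gx) (h2 k).
have := H10 w; have := H20 w.
by rewrite ler_norml dualN => *; apply/andP; split; lra.
Qed.

End SupportDomination.

(** * The key estimate *)

(** An ultrafilter limit stands in for a weak* convergent subsequence, which may fail to exist. *)
Lemma dual_ultralimit (R : realType) (X : normedModType R) (c : nat -> norm_dual X) :
  (forall n x, `|c n x| <= `|x|) ->
  exists (U : set_system nat) (z : norm_dual X), [/\ ProperFilter U, \oo `<=` U &
    forall x, (c n x : R) @[n --> U] --> (z x : R)].
Proof.
move=> cb; have [U [UU ooU]] := ultraFilterLemma eventually_filter.
have FU : ProperFilter U by exact: ultra_proper.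
have cvc x : exists l : R, (c n x : R) @[n --> U] --> l.
  apply: (@ultra_bounded_cvg _ _ _ _ (- `|x|) `|x|).
  by apply: filterS filterT => n _ /=; rewrite -ler_norml.
have [z zP] := choice cvc.
have zlin : linear (z : X -> R^o).
  move=> t x y; apply: (cvg_unique (@Rhausdorff R) (zP _)).
  have tx : (t * c n x : R) @[n --> U] --> t * z x.
    by apply: cvgM (zP x); exact: cvg_cst.
  have E : (fun n => c n (t *: x + y) : R) = (fun n => t * c n x + c n y).
    by apply/funext => n; rewrite linearD linearZ.
  by rewrite /mkset E; exact: cvgD tx (zP y).
have zb x : `|z x| <= 1 * `|x|.
  rewrite mul1r; apply: (cvgr_to_le (cvg_norm (zP x))).
  by apply: nearW => n.
have [f fz] := dual_intro zlin zb.
by exists U, f; split => // x; rewrite fz; exact: zP.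
Qed.

Section UpperIntegral.
Context (d : measure_display) (Omega : measurableType d) (R : realType).
Context (mu : {measure set Omega -> \bar R}) (D : set Omega) (mD : measurable D).
Context (T : Type) (S : Omega -> set T) (S0 : forall w, S w !=set0).
Context (H : Omega -> R) (iH : mu.-integrable D (EFin \o H)).
Hypothesis H0 : forall w, 0 <= H w.

Definition fiber_graph : set (Omega * T) := [set wx | D wx.1 /\ S wx.1 wx.2].

Local Notation U := (@dominated R (Omega * T) fiber_graph (fun wx => H wx.1)).

Definition upper_functions (F : Omega * T -> R) : set (Omega -> R) :=
  [set u : Omega -> R | mu.-integrable D (EFin \o u) /\
    forall w x, D w -> S w x -> F (w, x) <= u w].

(** This is the upper integral of [w |-> sup_(x in S w) F (w, x)], defined through majorants because
    the supremum may fail to be measurable. *)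
Definition upper_integral (F : Omega * T -> R) : R :=
  inf [set \int[mu]_(w in D) u w | u in upper_functions F].

Let scaleH_integrable C : mu.-integrable D (EFin \o (fun w => C * H w)).
Proof. exact: (integrableZl mD C iH). Qed.

(** Since fibres are nonempty, every majorant is at least [- C * H] on [D]. *)
Lemma upper_integral_has_inf F : (F : Omega * T -> R^o) \in U ->
  has_inf [set \int[mu]_(w in D) u w | u in upper_functions F].
Proof.
move=> /dominatedP[C FC]; split.
  exists (\int[mu]_(w in D) (C * H w)), (fun w => C * H w) => //.
  split => // w x Dw Sx.
  by rewrite (le_trans (ler_norm _))//; exact: (FC (w, x)).
exists (\int[mu]_(w in D) (- C * H w)) => _ [u [iu uF] <-].
apply: le_Rintegral => // w Dw; have [x Sx] := S0 w.
rewrite (le_trans _ (uF _ _ Dw Sx))// mulNr lerNl (le_trans (ler_norm _))// normrN.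
exact: (FC (w, x)).
Qed.

Lemma upper_integral_le F (u : Omega -> R) : (F : Omega * T -> R^o) \in U ->
  mu.-integrable D (EFin \o u) -> (forall w x, D w -> S w x -> F (w, x) <= u w) ->
  upper_integral F <= \int[mu]_(w in D) u w.
Proof.
by move=> FU iu uF; apply: ge_inf; [exact: (upper_integral_has_inf FU).2|exists u].
Qed.

Lemma le_upper_integral F a : (F : Omega * T -> R^o) \in U ->
  (forall u, upper_functions F u -> a <= \int[mu]_(w in D) u w) -> a <= upper_integral F.
Proof.
move=> FU aF; apply: lb_le_inf; first exact: (upper_integral_has_inf FU).1.
by move=> _ [u /aF ? <-].
Qed.

Lemma upper_integralD (F1 F2 : Omega * T -> R^o) : F1 \in U -> F2 \in U ->
  upper_integral (F1 + F2) <= upper_integral F1 + upper_integral F2.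
Proof.
move=> U1 U2; apply/ler_addgt0Pr => e e0; have e20 : 0 < e / 2 by rewrite divr_gt0.
have [_ [u [iu uF] <-] hu] := inf_adherent e20 (upper_integral_has_inf U1).
have [_ [v [iv vF] <-] hv] := inf_adherent e20 (upper_integral_has_inf U2).
rewrite -/(upper_integral F1) in hu; rewrite -/(upper_integral F2) in hv.
apply: (@le_trans _ _ (\int[mu]_(w in D) (u w + v w))).
  apply: upper_integral_le; first exact: rpredD.
    exact: (integrableD mD iu iv).
  by move=> w x Dw Sx; apply: lerD; [exact: uF|exact: vF].
rewrite RintegralD//; lra.
Qed.

Lemma upper_integralZ t (F : Omega * T -> R^o) : 0 < t -> F \in U ->
  upper_integral (t *: F) <= t * upper_integral F.
Proof.
move=> t0 FU; rewrite -ler_pdivrMl//; apply: le_upper_integral => // u [iu uF].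
rewrite ler_pdivrMl// -RintegralZl//; apply: upper_integral_le.
- exact: rpredZ.
- exact: (integrableZl mD t iu).
- by move=> w x Dw Sx; rewrite ler_pM2l//; exact: uF.
Qed.

Lemma upper_integral_nonpos F : (F : Omega * T -> R^o) \in U ->
  (forall wx, fiber_graph wx -> F wx <= 0) -> upper_integral F <= 0.
Proof.
move=> FU F0; rewrite (le_trans (@upper_integral_le F (fun=> 0) FU (integrable0 mu D) _))//.
  by move=> w x Dw Sx; exact: (F0 (w, x)).
by rewrite Rintegral_cst// mul0r.
Qed.

Lemma upper_integral0 : upper_integral (0 : Omega * T -> R^o) = 0.
Proof.
have U0 := rpred0 U; apply/eqP; rewrite eq_le upper_integral_nonpos//=.
apply: le_upper_integral => // u [iu u0]; apply: Rintegral_ge0 => w Dw.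
by have [x Sx] := S0 w; exact: (u0 w x).
Qed.

End UpperIntegral.

Section DecreasingMinima.
Context (d : measure_display) (Omega : measurableType d) (R : realType).
Context (mu : {measure set Omega -> \bar R}) (D : set Omega) (mD : measurable D).
Context (H : Omega -> R) (iH : mu.-integrable D (EFin \o H)).
Hypothesis H0 : forall w, 0 <= H w.
Variable v : nat -> Omega -> R.
Hypothesis mv : forall n, measurable_fun D (v n).
Hypothesis vH : forall n w, D w -> `|v n w| <= H w.

Fixpoint running_min (n : nat) (w : Omega) : R :=
  if n is m.+1 then Num.min (running_min m w) (v n w) else v 0%N w.

Lemma running_min_le n i w : (i <= n)%N -> running_min n w <= v i w.
Proof.
elim: n => [|n IHn]; first by rewrite leqn0 => /eqP ->.
rewrite leq_eqVlt => /predU1P[->|]; first by rewrite /= ge_min lexx orbT.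
by rewrite ltnS => /IHn h; rewrite /= ge_min h.
Qed.

Lemma le_running_min n w a : (forall i, (i <= n)%N -> a <= v i w) -> a <= running_min n w.
Proof.
elim: n => [|n IHn] h; first exact: h.
by rewrite /= le_min h// andbT IHn// => i ni; apply: h; exact: leqW.
Qed.

Lemma measurable_running_min n : measurable_fun D (running_min n).
Proof. by elim: n => [|n IHn] //=; exact: measurable_minr. Qed.

Lemma running_min_bound n w : D w -> `|running_min n w| <= H w.
Proof.
move=> Dw; elim: n => [|n IHn] /=; first exact: vH.
by rewrite /Num.min; case: ifP => // _; exact: vH.
Qed.

Lemma integrable_running_min n : mu.-integrable D (EFin \o running_min n).
Proof.
apply: (le_integrable mD _ _ iH); first exact/measurable_EFinP/measurable_running_min.
by move=> w Dw; rewrite lee_fin [leRHS]ger0_norm//; exact: running_min_bound.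
Qed.

Lemma running_min_integral_small (e : R) : 0 < e ->
  (\forall w \ae mu, D w -> forall a, 0 < a -> exists n, v n w < a) ->
  exists n, \int[mu]_(w in D) running_min n w < e.
Proof.
move=> e0 hv.
(* The minima may become negative; their positive parts dominate them and tend to 0 almost
   everywhere. *)
pose f n w := (Num.max (running_min n w) 0)%:E.
have mf n : measurable_fun D (f n).
  by apply/measurable_EFinP; apply: measurable_maxr => //; exact: measurable_running_min.
have f0 n w : (0 <= f n w)%E by rewrite lee_fin le_max lexx orbT.
have fH n w : D w -> (`|f n w| <= (H w)%:E)%E.
  move=> Dw; rewrite gee0_abs// lee_fin ge_max H0 andbT.
  by rewrite (le_trans (ler_norm _))// running_min_bound.
have [] := @dominated_convergence _ _ _ mu D mD f (cst 0%E) (EFin \o H) mf.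
- exact: measurable_cst.
- apply: filterS hv => w hw Dw.
  apply/fine_cvgP; split; first by apply: nearW.
  apply/cvgrPdist_lt => a a0; have [n vn] := hw Dw _ a0.
  near=> m; rewrite /= sub0r normrN ger0_norm; last by rewrite le_max lexx orbT.
  rewrite gt_max a0 andbT (le_lt_trans _ vn)//; apply: running_min_le.
  by near: m; exact: nbhs_infty_ge.
- exact: iH.
- by apply: nearW => w n; exact: fH.
move=> _ _; rewrite integral0 => /fine_cvgP[_ /cvgrPdist_lt/(_ _ e0)].
move=> [N _ /(_ N (leqnn N))] /=; rewrite sub0r normrN => hN.
exists N; apply: le_lt_trans hN; rewrite (le_trans _ (ler_norm _))//.
apply: le_Rintegral => //; first exact: integrable_running_min.
  apply: (le_integrable mD (mf N) _ iH) => w Dw.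
  by rewrite [leRHS]gee0_abs ?lee_fin//; exact: fH.
by move=> w _; rewrite le_max lexx.
Unshelve. all: by end_near. Qed.

End DecreasingMinima.

Section KeyEstimate.
Context (d : measure_display) (Omega : measurableType d) (R : realType).
Context (mu : {measure set Omega -> \bar R}) (X : normedModType R).
Variable (G : Omega -> set X).
Hypothesis cG : forall w, cwk (G w).
Hypothesis iG : scalarly_integrable mu G.
Variables (A : set Omega) (mA : measurable A).

Definition supp_integral (f : norm_dual X) : R := \int[mu]_(w in A) supp f (G w).

Lemma supp_integrable (D : set Omega) f : measurable D ->
  mu.-integrable D (EFin \o (fun w => supp f (G w))).
Proof. by move=> mD; exact: integrableS measurableT mD (subsetT _) (iG f). Qed.

Lemma supp_integral_sublinear : sublinear supp_integral.
Proof.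
apply: sublinearP => [|f g|t f t0].
- rewrite /supp_integral (_ : (fun w => supp 0 (G w)) = cst 0).
    by rewrite Rintegral_cst// mul0r.
  by apply/funext => w; exact: sublinear0 (supp_sublinear (cG w)).
- rewrite /supp_integral -RintegralD//; [|exact: supp_integrable..].
  apply: le_Rintegral => //; first exact: supp_integrable.
    exact: (integrableD mA (supp_integrable f mA) (supp_integrable g mA)).
  by move=> w _; exact: (supp_sublinear (cG w)).1.
- rewrite /supp_integral -RintegralZl//; last exact: supp_integrable.
  apply: le_Rintegral => //; first exact: supp_integrable.
    exact: (integrableZl mA t (supp_integrable f mA)).
  by move=> w _; rewrite (supp_sublinear (cG w)).2// ltW.
Qed.

Context (Y : submodClosed X).
Hypothesis detY : forall f, annihilator Y f -> \forall w \ae mu, supp f (G w) = 0.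

Definition average (c : nat -> norm_dual X) (s : seq nat) : norm_dual X :=
  (size s)%:R^-1 *: \sum_(i <- s) c i.

(** An enumeration of all nonempty lists, with [[:: 0]] as default value. Countability allows the
    infimum over all averages to be reached by running minima. *)
Definition nth_index_list (n : nat) : seq nat :=
  if unpickle n is Some (k :: s) then k :: s else [:: 0%N].

Lemma nth_index_list_size n : (0 < size (nth_index_list n))%N.
Proof. by rewrite /nth_index_list; case: unpickle => // -[]. Qed.

Lemma nth_index_list_surj (s : seq nat) : (0 < size s)%N -> exists n, nth_index_list n = s.
Proof. by case: s => // k s _; exists (pickle (k :: s)); rewrite /nth_index_list pickleK. Qed.

Lemma average_itv (c : nat -> norm_dual X) (s : seq nat) x (a b : R) : (0 < size s)%N ->
  (forall i, i \in s -> a <= c i x <= b) -> a <= average c s x <= b.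
Proof.
move=> s0 ac; have sE (r : R) : (size s)%:R * r = \sum_(i <- s) r.
  by rewrite big_const_seq count_predT iter_addr_0 mulr_natl.
rewrite dualZ dual_sum ler_pdivlMl ?ltr0n// ler_pdivrMl ?ltr0n// !sE.
rewrite !big_seq; apply/andP; split; apply: ler_sum => i is_.
  by case/andP: (ac _ is_).
by case/andP: (ac _ is_).
Qed.

Section Decreasing.
Variable c : nat -> norm_dual X.
Hypothesis cb : forall n x, `|c n x| <= `|x|.
Hypothesis cY : forall y, y \in Y -> (c n y : R) @[n --> \oo] --> (0 : R).

(* If all averages of the c n had support function at least a > 0 at G w, then by
   minimax a point of G w would have all c n above a / 2; but a weak* cluster
   point of the c n annihilates Y, so it vanishes on G w. *)
Lemma supp_average_small : \forall w \ae mu, forall a, 0 < a ->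
  exists n, supp (average c (nth_index_list n)) (G w) < a.
Proof.
have [U [z [FU ooU cz]]] := dual_ultralimit cb.
have zY : annihilator Y z.
  move=> y yY; apply: (cvg_unique (@Rhausdorff R) (cz y)).
  by apply: cvg_trans (cY yY) => B /ooU.
apply: filterS (detY zY) => w zw a a0; apply: contrapT => /forallNP hn.
have {}hn n : a <= supp (average c (nth_index_list n)) (G w).
  by rewrite leNgt; apply/negP; exact: hn.
have a20 : 0 < a / 2 by rewrite divr_gt0.
have [sD sZ] := supp_sublinear (cG w).
have [|x Gx hx] := minimax (c := c) (a := a) (cG w) a20.
  move=> s; have [s0|s0] := posnP (size s).
    by rewrite (size0nil s0) mulr0 big_nil (sublinear0 (supp_sublinear (cG w))).
  have [n ns] := nth_index_list_surj s0.
  have := hn n; rewrite ns /average sZ ?invr_ge0//.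
  by rewrite ler_pdivlMl ?ltr0n// mulrC.
have : a - a / 2 <= z x by apply: (cvgr_to_ge (cz x)); exact: nearW.
have := supp_ge z (cG w) Gx; rewrite zw => zx0 /le_trans /(_ zx0).
lra.
Qed.

End Decreasing.

Lemma tail_hull_cvg0 g (c : nat -> norm_dual X) (y : X) : (forall n, tail_hull g n (c n)) ->
  (g n y : R) @[n --> \oo] --> (0 : R) -> (c n y : R) @[n --> \oo] --> (0 : R).
Proof.
move=> gc /cvgrPdist_le gy; apply/cvgrPdist_le => e e0.
have [N _ hN] := gy e e0; exists N => // n /= Nn.
rewrite sub0r normrN; move: (c n) (tail_hull_le Nn (gc n)).
apply: hull_min => [u v t /andP[t0 t1] ux vx|_ [k /= Nk <-]].
  have t1' : 0 <= 1 - t by rewrite subr_ge0.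
  rewrite /mkset dualD !dualZ (le_trans (ler_normD _ _))// !normrM.
  rewrite (ger0_norm t0) (ger0_norm t1').
  by have := ler_wpM2l t0 ux; have := ler_wpM2l t1' vx; lra.
by have := hN k Nk; rewrite /= sub0r normrN.
Qed.

Lemma geometric_half_sum (e : R) m : 0 <= e ->
  \sum_(j < m) e / (2 ^ j.+1)%:R <= e.
Proof.
move=> e0; suff : \sum_(j < m) e / (2 ^ j.+1)%:R = e - e / (2 ^ m)%:R.
  by move=> ->; rewrite lerBlDr lerDl divr_ge0.
elim: m => [|m IHm]; first by rewrite big_ord0 expn0 divr1 subrr.
rewrite big_ord_recr/= IHm expnS natrM; field.
by rewrite pnatr_eq0 expn_eq0.
Qed.

Lemma small_integral (g : nat -> norm_dual X) (H : Omega -> R) (e : R) :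
  (forall n x, `|g n x| <= `|x|) ->
  mu.-integrable setT (EFin \o H) -> (forall w, 0 <= H w) ->
  (\forall w \ae mu, forall k x, G w x -> `|g k x| <= H w) ->
  (forall y, y \in Y -> (g n y : R) @[n --> \oo] --> (0 : R)) -> 0 < e ->
  exists2 c, tail_hull g 0 c & supp_integral c < e.
Proof.
move=> gb iH H0 [N [mN N0 hN]] gY e0; apply: contrapT => hc.
have {}hc c : tail_hull g 0 c -> e <= supp_integral c.
  by move=> gc; rewrite leNgt; apply/negP => ce; apply: hc; exists c.
(* Removing the null set makes the domination valid at every point of the graph over [D] and leaves
   the integrals unchanged. *)
pose D := A `\` N; have mD : measurable D by exact: measurableD.
have gH w k x : D w -> G w x -> `|g k x| <= H w.
  move=> [_ Nw]; move: k x; apply: contrapT => hw; exact/Nw/hN.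
have iHD : mu.-integrable D (EFin \o H) by exact: integrableS measurableT mD (subsetT _) iH.
have ZE f : supp_integral f = \int[mu]_(w in D) supp f (G w).
  rewrite /supp_integral /Rintegral (negligible_integral mN mA _ N0)//.
  exact: supp_integrable.
have G0 w : G w !=set0 by have [] := cG w.
pose E := fiber_graph D G.
pose h (wx : Omega * X) := H wx.1.
pose U := @dominated R (Omega * X)%type E h.
have h0 wx : E wx -> 0 <= h wx by move=> _; exact: H0.
pose fn (c : norm_dual X) : Omega * X -> R^o := fun wx => c wx.2.
have gh k wx : E wx -> `|dual_at wx.2 (g k)| <= h wx.
  by move=> [Dw Gx]; exact: gH.
have hull_h c wx : tail_hull g 0 c -> E wx -> `|c wx.2| <= h wx.
  by move=> gc Ex; exact: (ev_hull gh gc Ex).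
have fnU c : tail_hull g 0 c -> fn c \in U.
  by move=> gc; apply/dominatedP; exists 1 => wx Ewx; rewrite mul1r; exact: hull_h.
pose C : set (Omega * X -> R^o) := [set fn c | c in tail_hull g 0].
have cC : convex C.
  move=> _ _ t t01 [c gc <-] [c' gc' <-]; exists (t *: c + (1 - t) *: c') => //.
  exact: hull_convex.
have C0 : C !=set0 by exists (fn (g 0%N)), (g 0%N) => //; apply: hull_in; exists 0%N.
have Cp F : C F -> F \in U /\ e <= upper_integral mu D G F.
  move=> [c gc <-]; split; first exact: fnU.
  apply: (le_upper_integral mD G0 iHD) => [|u [iu uF]]; first exact: fnU.
  rewrite (le_trans (hc _ gc))// ZE; apply: le_Rintegral => //; first exact: supp_integrable.
  by move=> w Dw; apply: supp_le => // x; exact: uF.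
have [L [L_linear Lp LC]] := sandwich_convex_on
  (upper_integralD mD G0 iHD) (upper_integralZ mD G0 iHD)
  (upper_integral0 mD G0 iHD) cC C0 Cp.
have L_pos (F : Omega * X -> R) : (F : _ -> R^o) \in U ->
    (forall x, E x -> F x <= 0) -> L F <= 0.
  by move=> FU F0; rewrite (le_trans (Lp _ FU))//; exact: (upper_integral_nonpos mD G0 iHD).
have e20 : 0 < e / 2 by rewrite divr_gt0.
(* These tolerances sum to at most [e / 2]. *)
pose ej j := e / 2 / (2 ^ j.+1)%:R.
have [||c cP] := @almost_stationary_hull _ _ E h h0 L L_linear L_pos _
  (fun wx => dual_at wx.2) g gh ej.
- by move=> j; rewrite divr_gt0// ltr0n expn_gt0.
- move=> j; rewrite ler_wpM2l ?(ltW e20)// lef_pV2 ?posrE ?ltr0n ?expn_gt0//.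
  by rewrite ler_nat leq_exp2l.
have gc j : tail_hull g 0 (c j) by have [gcj _] := cP j; exact: tail_hull_le gcj.
(* Accumulated variation: [c 0 - F m] lies below each of [c 0], ..., [c m], hence below their
   averages. *)
pose F m (wx : Omega * X) : R := \sum_(j < m) `|(c j - c j.+1) wx.2|.
have dU j : ((fun wx => `|(c j - c j.+1) wx.2|) : Omega * X -> R^o) \in U.
  apply/dominatedP; exists 2 => wx Ewx.
  rewrite normr_id dualB (le_trans (ler_normB _ _))// mulrDl mul1r.
  by apply: lerD; exact: hull_h.
have FS m : (F m.+1 : _ -> R^o) = 1 *: (F m : Omega * X -> R^o) +
    ((fun wx => `|(c m - c m.+1) wx.2|) : Omega * X -> R^o).
  by rewrite scale1r; apply/funext => wx; rewrite /F big_ord_recr.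
have F0 : (F 0%N : _ -> R^o) = 0 by apply/funext => wx; rewrite /F big_ord0.
have FU m : (F m : _ -> R^o) \in U.
  by elim: m => [|m IHm]; rewrite ?F0 ?rpred0// FS rpredD// rpredZ.
have LF m : L (F m) <= e / 2.
  rewrite (le_trans _ (geometric_half_sum m (ltW e20)))//.
  elim: m => [|m IHm].
    rewrite F0 big_ord0; apply: L_pos; first exact: rpred0.
    by [].
  rewrite FS L_linear// mul1r big_ord_recr/= lerD//.
  by have [_] := cP m.
have cF m k wx : (k <= m)%N -> c 0%N wx.2 - F m wx <= c k wx.2.
  elim: m k => [|m IHm] k; first by rewrite leqn0 => /eqP ->; rewrite /F big_ord0 subr0.
  rewrite /F big_ord_recr/= -/(F m wx) leq_eqVlt => /predU1P[->|].
    have := IHm m (leqnn _); have := ler_norm ((c m - c m.+1) wx.2).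
    by rewrite [X in X <= _]dualB; lra.
  rewrite ltnS => /IHm; have := normr_ge0 ((c m - c m.+1) wx.2); lra.
have cb n x : `|c n x| <= `|x| by exact: tail_hull_bounded gb (gc n) _.
have cY y : y \in Y -> (c n y : R) @[n --> \oo] --> (0 : R).
  by move=> yY; apply: tail_hull_cvg0 (gY y yY) => n; have [] := cP n.
pose v n w := supp (average c (nth_index_list n)) (G w).
have avgH n w x : D w -> G w x -> `|average c (nth_index_list n) x| <= H w.
  move=> Dw Gx; rewrite ler_norml; apply: average_itv; first exact: nth_index_list_size.
  by move=> i _; rewrite -ler_norml; exact: (hull_h _ (w, x)).
have mv n : measurable_fun D (v n).
  apply/measurable_EFinP.
  by case/integrableP: (supp_integrable (average c (nth_index_list n)) mD).
have vH n w : D w -> `|v n w| <= H w.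
  move=> Dw; rewrite ler_norml; apply/andP; split; last first.
    by apply: supp_le => // x Gx; exact: le_trans (ler_norm _) (avgH _ _ _ Dw Gx).
  have [x Gx] := G0 w; rewrite (le_trans _ (supp_ge _ (cG w) Gx))// lerNl.
  by rewrite (le_trans (ler_norm _))// normrN; exact: avgH Gx.
have hv : \forall w \ae mu, D w -> forall a, 0 < a -> exists n, v n w < a.
  by apply: filterS (supp_average_small cb cY) => w hw _; exact: hw.
have [n vn] := running_min_integral_small mD iHD H0 mv vH e20 hv.
(* No index in the lists numbered 0 to [n] exceeds [m], so [c 0 - F m] lies below every average
   entering the running minimum. *)
pose m := \max_(i < n.+1) \max_(k <- nth_index_list i) k.
have km i k : (i <= n)%N -> k \in nth_index_list i -> (k <= m)%N.
  move=> ni ki; rewrite (leq_trans (leq_bigmax_seq k ki isT))//.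
  exact: (leq_bigmax (Ordinal (ni : (i < n.+1)%N))).
have cFU : ((fun wx => c 0%N wx.2 - F m wx) : Omega * X -> R^o) \in U.
  by apply: (rpredB (fnU _ (gc 0%N)) (FU m)).
have cFn : upper_integral mu D G (fun wx => c 0%N wx.2 - F m wx) < e / 2.
  apply: le_lt_trans vn; apply: (upper_integral_le mD G0 iHD cFU).
    exact: (integrable_running_min mD iHD H0 mv vH).
  move=> w x Dw Gx; apply: le_running_min => i ni.
  rewrite (le_trans _ (supp_ge _ (cG w) Gx))//.
  suff /andP[] : c 0%N x - F m (w, x) <= average c (nth_index_list i) x <= `|x| by [].
  apply: average_itv => [|k ki]; first exact: nth_index_list_size.
  rewrite (cF m k (w, x))/=; last exact: km ki.
  exact: le_trans (ler_norm _) (cb _ _).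
(* [L] is at least [e] at [c 0], yet [c 0] is the sum of [c 0 - F m], where [L] is below [e / 2],
   and [F m], where it is at most [e / 2]. *)
have := LC (fn (c 0%N)) (ex_intro2 _ _ _ (gc 0%N) erefl).
have -> : fn (c 0%N) =
    1 *: ((fun wx => c 0%N wx.2 - F m wx) : Omega * X -> R^o) + (F m : _ -> R^o).
  by rewrite scale1r; apply/funext => wx; rewrite [RHS]subrK.
rewrite L_linear// mul1r.
by have := Lp _ cFU; have := LF m; lra.
Qed.

End KeyEstimate.

(** * Pettis integrability of a single level *)

Section MultifunctionPettis.
Context (d : measure_display) (Omega : measurableType d) (R : realType).
Context (mu : {measure set Omega -> \bar R}) (X : completeNormedModType R).
Variable (G : Omega -> set X).
Hypothesis cG : forall w, cwk (G w).
Hypothesis iG : scalarly_integrable mu G.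
Hypothesis hT : weakly_compact_op (supp_op iG).
Context (Y : submodClosed X).
Hypothesis hY : weak_star_angelic (@subspace_norm R X Y).
Hypothesis detY : forall f, annihilator Y f -> \forall w \ae mu, supp f (G w) = 0.
Variables (A : set Omega) (mA : measurable A).

Lemma dual_restriction : exists rho : norm_dual X -> dual (@subspace_norm R X Y),
  forall f y, rho f y = f (val y).
Proof.
have /choice[rho rhoE] (f : norm_dual X) :
    exists g : dual (@subspace_norm R X Y), forall y, g y = f (val y).
  have [M fM] := dual_bounded f.
  apply: (dual_intro (M := M)) => [t u v|y]; last exact: fM.
  by rewrite !linearD/= !linearZ.
by exists rho.
Qed.

(* If every finite set of points were annihilated by an f in the unit ball with
   z f > e, then 0 would be in the weak* closure of the restrictions of such f to Y. *)
Lemma angelic_sequence (z : norm_dual X -> R) (e : R) :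
  (forall s : seq X, exists f : norm_dual X,
    [/\ forall x, `|f x| <= `|x|, forall x, x \in s -> f x = 0 & e < z f]) ->
  exists f : nat -> norm_dual X,
    [/\ forall n x, `|f n x| <= `|x|, forall n, e < z (f n) &
      forall y, y \in Y -> (f n y : R) @[n --> \oo] --> (0 : R)].
Proof.
move=> hs; have [rho rhoE] := dual_restriction.
pose B := [set f : norm_dual X | (forall x, `|f x| <= `|x|) /\ e < z f].
have bB : dual_bounded_set (rho @` B).
  exists 1 => _ [f [fb _] <-] y; rewrite mul1r rhoE; exact: fb.
(* Along this filter, indexed by finite sets of points, every evaluation is eventually 0. *)
pose F : set_system (norm_dual X) :=
  filter_from [set: seq X] (fun s => [set f | B f /\ forall x, x \in s -> f x = 0]).
have FF : ProperFilter F.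
  apply: filter_from_proper => [|s _]; last by have [f [fb fs fz]] := hs s; exists f.
  apply: filter_from_filter => [|s t _ _]; first by exists [::].
  exists (s ++ t) => // f [Bf fst]; split; split=> // x xs; apply: fst.
    by rewrite mem_cat xs.
  by rewrite mem_cat xs orbT.
pose W := weak_star_topology (@subspace_norm R X Y).
have cl0 : closure (rho @` B : set W) (0 : dual (@subspace_norm R X Y)).
  rewrite closureEcvg; exists (rho @ F); first exact: fmap_proper_filter.
  split; last first.
    by move=> S BS; exists [::] => // f [Bf _]; apply: BS; exists f.
  apply: weak_star_cvg => y; rewrite dual0.
  apply: cvg_near_cst; exists [:: val y] => // f [_ fy] /=.
  by rewrite rhoE fy// mem_seq1.
rewrite (hY bB) in cl0; have [u [Bu u0]] := cl0.
have /choice[f fP] (n : nat) : exists f, B f /\ rho f = u n.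
  by have [f Bf <-] := Bu n; exists f.
exists f; split => [n x|n|y yY].
- by have [[fb _] _] := fP n.
- by have [[_ fz] _] := fP n.
have := @eval_weak_star_continuous R _ (@subspace_norm R X Y) (exist _ y yY)
  (0 : dual (@subspace_norm R X Y)).
move=> /(cvg_comp _ _ u0); rewrite dual0.
rewrite (_ : _ \o u = fun n => (f n y : R))//.
by apply/funext => n /=; have [_ <-] := fP n; rewrite rhoE.
Qed.

(** If Grothendieck's criterion failed, the angelic sequence would have convex combinations on all
    of which [z] is at least [e], while [supp_integral] is below [e] at one of them. *)
Lemma dominated_eval (z : {linear norm_dual X -> R^o}) :
  (forall f, z f <= supp_integral mu G A f) -> exists x, forall f, z f = f x.
Proof.
move=> zle; apply: grothendieck_eval => e e0; apply: contrapT => /forallNP hs.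
have [|f [fb fz fY]] := @angelic_sequence z e.
  move=> s; apply: contrapT => /forallNP hf; apply: (hs s) => f fb fs.
  by rewrite leNgt; apply/negP => ez; apply: (hf f).
have [g [H [fg iH H0 gH]]] := eval_domination cG hT fb.
have gb n x : `|g n x| <= `|x| by exact: tail_hull_bounded fb (fg n) _.
have gY y : y \in Y -> (g n y : R) @[n --> \oo] --> (0 : R).
  by move=> /fY; exact: tail_hull_cvg0.
have [c gc ce] := small_integral cG iG mA detY gb iH H0 gH gY e0.
have : e <= z c.
  have := tail_hull_trans fg gc; move: c {gc ce}.
  apply: hull_min => [u v t /andP[t0 t1] eu ev|_ [n _ <-]]; last exact: ltW.
  have t1' : 0 <= 1 - t by rewrite subr_ge0.
  rewrite /mkset linearD !linearZ/=.
  have := ler_wpM2l t0 eu; have := ler_wpM2l t1' ev.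
  by rewrite /GRing.scale/=; lra.
by have := zle c; move=> zc ez; have := le_lt_trans (le_trans ez zc) ce; rewrite ltxx.
Qed.

(** The candidate for the Pettis integral of [G] over [A]. *)
Definition integral_set : set X := dominated_points (supp_integral mu G A).

Lemma cwk_integral_set : cwk integral_set.
Proof.
apply: cwk_dominated_points; first exact: supp_integral_sublinear.
exact: dominated_eval.
Qed.

Lemma supp_integral_set f :
  (supp f integral_set)%:E = (\int[mu]_(w in A) (supp f (G w))%:E)%E.
Proof.
rewrite supp_dominated_points.
- rewrite /supp_integral /Rintegral fineK//; apply: integrable_fin_num => //.
  exact: supp_integrable.
- exact: supp_integral_sublinear.
- exact: dominated_eval.
Qed.

End MultifunctionPettis.

(** * Left continuity in the level *)

Section FuzzyLevels.
Context (d : measure_display) (Omega : measurableType d) (R : realType).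
Context (mu : {measure set Omega -> \bar R}) (X : normedModType R).
Variable G : Omega -> fuzzy_number X.
Hypothesis hG : fuzzy_scalarly_integrable mu G.
Variables (A : set Omega) (mA : measurable A).

Lemma level_le (u : X -> R) (q r : R) : q <= r -> level u r `<=` level u q.
Proof. by move=> qr x; exact: le_trans. Qed.

(** Otherwise the levels [q n], cut by the half-space where [f] is at least
    [supp f (level u r) + e], are nested, nonempty and weakly compact. A common point lies in level
    [r] because [q n] tends to [r], which is absurd. *)
Lemma supp_level_cvg (u : fuzzy_number X) (q : nat -> R) (r : R) (f : norm_dual X) :
  0 < r <= 1 -> (forall n, 0 < q n) -> (forall m n, (m <= n)%N -> q m <= q n) ->
  (forall n, q n <= r) -> q n @[n --> \oo] --> r ->
  supp f (level u (q n)) @[n --> \oo] --> supp f (level u r).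
Proof.
move=> r01 q0 qm qr cq; have [r0 r1] := andP r01.
have q01 n : 0 < q n <= 1 by rewrite q0 (le_trans (qr n)).
have cq' n := fuzzy_level u (q01 n); have cr := fuzzy_level u r01.
apply/cvgrPdist_lt => e e0.
have le_supp n : supp f (level u r) <= supp f (level u (q n)).
  by apply: supp_subset => //; exact: level_le.
suff [N hN] : exists N, supp f (level u (q N)) < supp f (level u r) + e.
  exists N => // n /= Nn; rewrite distrC ger0_norm ?subr_ge0// ltrBlDl addrC.
  rewrite addrC (le_lt_trans _ hN)//.
  by apply: supp_subset => //; exact: level_le (qm _ _ Nn).
apply: contrapT => /forallNP hN.
have {}hN n : supp f (level u r) + e <= supp f (level u (q n)) by rewrite leNgt; exact/negP.
pose C n : set (norm_weak_topology X) :=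
  level u (q n) `&` [set x | supp f (level u r) + e <= f x].
have ccl : closed [set x : norm_weak_topology X | supp f (level u r) + e <= (f x : R)].
  apply: (@preimage_closed _ _ (fun x : norm_weak_topology X => f x : R)
    [set t | supp f (level u r) + e <= t]); last exact: closed_ge.
  by move=> x _; exact: dual_weakly_continuous.
have [x Cx] : exists x, forall n, C n x.
  apply: nested_compact => [m n mn x [ux fx]|n|n|].
  - by split=> //; exact: level_le (qm _ _ mn) _ ux.
  - by apply: closedI => //; exact: cwk_closed.
  - by have [x ux fx] := supp_attained f (cq' n); exists x; split=> //=; rewrite fx.
  - apply: (subclosed_compact _ _ (@subIsetl _ _ _)).
      by apply: closedI => //; exact: cwk_closed.
    by have [] := cq' 0%N.
have ux : level u r x.
  by apply: (cvgr_to_le cq); apply: nearW => n; have [] := Cx n.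
have [_ /=] := Cx 0%N; have := supp_ge f cr ux; lra.
Qed.

Lemma supp_integral_level_cvg (q : nat -> R) (r : R) (f : norm_dual X) :
  0 < r <= 1 -> (forall n, 0 < q n) -> (forall m n, (m <= n)%N -> q m <= q n) ->
  (forall n, q n <= r) -> q n @[n --> \oo] --> r ->
  supp_integral mu (fun w => level (G w) (q n)) A f @[n --> \oo] -->
    supp_integral mu (fun w => level (G w) r) A f.
Proof.
move=> r01 q0 qm qr cq; have [r0 r1] := andP r01.
have q01 n : 0 < q n <= 1 by rewrite q0 (le_trans (qr n)).
pose F n w := (supp f (level (G w) (q n)))%:E.
pose F' w := (supp f (level (G w) r))%:E.
have iF n : mu.-integrable A (F n) := supp_integrable (hG (q01 n)) f mA.
have iF' : mu.-integrable A F' := supp_integrable (hG r01) f mA.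
(* Levels decrease as [q n] increases to [r], so [F n] lies between [F'] and [F 0]; hence this
   dominating function. *)
have [] := @dominated_convergence _ _ _ mu A mA F F' (fun w => `|F 0%N w| + `|F' w|)%E.
- by move=> n; case/integrableP : (iF n).
- by case/integrableP : iF'.
- apply: nearW => w _; apply/fine_cvgP; split; first exact: nearW.
  exact: supp_level_cvg.
- by apply: integrableD => //; exact: integrable_abse.
- apply: nearW => w n _; rewrite /F /F' -EFinD !abse_EFin lee_fin.
  have h1 : supp f (level (G w) r) <= supp f (level (G w) (q n)).
    by apply: supp_subset; [exact: fuzzy_level..|exact: level_le].
  have h2 : supp f (level (G w) (q n)) <= supp f (level (G w) (q 0%N)).
    by apply: supp_subset; [exact: fuzzy_level..|apply: level_le; exact: qm].
  move: h1 h2; set a := supp _ _; set b := supp _ _; set c := supp _ _.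
  have := ler_norm c; have := ler_norm (- a); rewrite normrN ler_norml.
  have := normr_ge0 a; have := normr_ge0 c.
  by move=> *; apply/andP; split; lra.
move=> _ _; rewrite /supp_integral /Rintegral => h.
by apply: fine_cvg; rewrite fineK//; exact: integrable_fin_num.
Qed.

End FuzzyLevels.

Theorem theorem3p8 (R : realType) (d : measure_display)
  (Omega : measurableType d) (mu : {measure set Omega -> \bar R})
  (X : completeNormedModType R) (G : Omega -> fuzzy_number X)
  (hG : fuzzy_scalarly_integrable mu G)
  (Y : submodClosed X)
  (hY : weak_star_angelic (@subspace_norm R X Y))
  (hdet : determines mu Y G)
  (hT : forall (r : R) (hr : 0 < r <= 1), weakly_compact_op (supp_op (hG r hr))) :
  fuzzy_pettis_integrable mu G.
Proof.
have cG r (r01 : 0 < r <= 1) w : cwk (level (G w) r) := fuzzy_level (G w) r01.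
have cW r (r01 : 0 < r <= 1) A (mA : measurable A) :=
  cwk_integral_set (cG r r01) (hT r r01) hY (hdet r r01) mA.
have sW r (r01 : 0 < r <= 1) A (mA : measurable A) :=
  supp_integral_set (cG r r01) (hT r r01) hY (hdet r r01) mA.
split=> [r r01|A mA].
  split=> [|A mA]; first exact (hG r r01).
  by exists (integral_set mu (fun w => level (G w) r) A); [exact: cW|move=> f; exact: sW].
pose W r := integral_set mu (fun w => level (G w) r) A.
(* Including 0 keeps the set nonempty and gives the value 0 to points outside every [W r]. *)
pose I x := [set r | r = 0 \/ (0 < r <= 1 /\ W r x)].
have hI x : has_sup (I x).
  split; first by exists 0; left.
  by exists 1 => r [->//|[/andP[]]].
pose M x := sup (I x).
have M01 x : 0 <= M x <= 1.
  apply/andP; split; first by apply: ub_le_sup; [exact: (hI x).2|left].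
  by apply: ge_sup; [exact: (hI x).1|move=> r [->//|[/andP[]]]].
have Wdec q r : 0 < q -> q <= r -> r <= 1 -> W r `<=` W q.
  move=> q0 qr r1 x Wx f; rewrite (le_trans (Wx f))//.
  have r01 : 0 < r <= 1 by rewrite (lt_le_trans q0)//= r1.
  have q01 : 0 < q <= 1 by rewrite q0 (le_trans qr).
  apply: le_Rintegral => //; [exact: supp_integrable (hG _ _) _ _ _..|].
  by move=> w _; apply: supp_subset; [exact: cG|exact: cG|exact: level_le].
(* The supremum [M x] may not be attained, so [r <= M x] directly gives membership in [W q] for
   [q < r]; the case of [r] follows by letting [q] increase to [r] in the integrals. *)
have levelM r : 0 < r <= 1 -> level M r = W r.
  move=> r01; have [r0 r1] := andP r01; apply/seteqP; split=> x; last first.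
    by move=> Wx; apply: ub_le_sup; [exact: (hI x).2|right].
  move=> rM f.
  (* The denominator [n + 2] keeps every term positive, starting from [r / 2]. *)
  pose q n := r - r / n.+2%:R.
  have q0 n : 0 < q n.
    by rewrite subr_gt0 ltr_pdivrMr// ltr_pMr// ltr1n.
  have qm m n : (m <= n)%N -> q m <= q n.
    move=> mn; rewrite lerB// ler_wpM2l ?(ltW r0)// lef_pV2 ?posrE//.
    by rewrite ler_nat.
  have qr n : q n < r by rewrite ltrBlDr ltrDl divr_gt0.
  have cq : q n @[n --> \oo] --> r.
    rewrite -[X in _ --> X]subr0; apply: cvgB; first exact: cvg_cst.
    rewrite -(mulr0 r); apply: cvgM; first exact: cvg_cst.
    have := @cvg_harmonic R; rewrite -cvg_shiftS; exact.
  have := supp_integral_level_cvg (f := f) hG mA r01 q0 qm (fun n => ltW (qr n)) cq.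
  move=> /cvgr_to_ge; apply; apply: nearW => n.
  have qM : 0 < sup (I x) - q n by rewrite subr_gt0 (lt_le_trans (qr n)).
  have [s Is] := sup_adherent qM (hI x); rewrite subKr => qs.
  case: Is => [s0|[/andP[s0 s1] Ws]]; first by have := q0 n; lra.
  exact: (Wdec _ _ (q0 n) (ltW qs) s1 _ Ws).
have cM r : 0 < r <= 1 -> cwk (level M r).
  by move=> r01; rewrite levelM//; exact: cW.
exists (FuzzyNumber M01 cM) => r r01 f.
by rewrite -(sW r r01 A mA) /= levelM.
Qed.
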